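(* Let $k$ be a positive integer and let $a\in\mathbb{C}$ be a constant. There exists a bounded linear operator $T_k:L^2(\mathbb{C},e^{-|z|^2})\rightarrow L^2(\mathbb{C},e^{-|z|^2})$ such that $$\left(\overline{\partial}^k+a\right)T_k=I \quad\text{and}\quad \|T_k\|\leq\frac{1}{\sqrt{k!}},$$ where $\|T_k\|$ is the operator norm of $T_k$ on $L^2(\mathbb{C},e^{-|z|^2})$ and $I$ is the identity operator; that is, for every $f\in L^2(\mathbb{C},e^{-|z|^2})$ the function $u=T_kf$ is a weak solution of $\overline{\partial}^k u+au=f$ in $\mathbb{C}$.
   Context: $d\sigma=\frac{1}{2i}d\overline{z}\wedge dz$ is the area (Lebesgue) measure on $\mathbb{C}$. $\frac{\partial}{\partial\overline z}=\frac12\left(\frac{\partial}{\partial x}+i\frac{\partial}{\partial y}\right)$ and $\overline{\partial}^k=\frac{\partial^k}{\partial\overline{z}^k}$. $L^2(\mathbb{C},e^{-|z|^2})$ is the Hilbert space of complex-valued $f\in L^2_{loc}(\mathbb{C})$ with finite norm $\left(\int_{\mathbb{C}}|f|^2e^{-|z|^2}d\sigma\right)^{1/2}$. For $u,g\in L^2_{loc}(\mathbb{C})$, $\overline{\partial}^k u=g$ holds in the weak sense if $\int_{\mathbb{C}}u\,\overline{\partial}^k\phi\, d\sigma=(-1)^k\int_{\mathbb{C}}g\phi\, d\sigma$ for all $\phi\in C_0^\infty(\mathbb{C})$ (smooth compactly supported complex-valued functions). A weak solution of $\overline{\partial}^k u+au=f$ is a $u$ such that $\overline{\partial}^k u=f-au$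 in the weak sense. *)

(* Defs.v *)
From HB Require Import structures.
From mathcomp Require Import all_boot all_order all_algebra.
From mathcomp Require Import generic_quotient ring_quotient.
From mathcomp Require Import complex.
From mathcomp Require Import all_classical all_reals all_analysis.
From mathcomp Require Import measurable_realfun ring.

Set Implicit Arguments.
Unset Strict Implicit.
Unset Printing Implicit Defensive.

Import Order.TTheory GRing.Theory Num.Theory.
Import numFieldNormedType.Exports.

Local Open Scope classical_set_scope.
Local Open Scope ring_scope.
Local Open Scope complex_scope.

(* [R[i]] carries neither a measurable nor a real normed structure in the
   libraries, so analysis on it goes through the identification with [R * R]:
   a function [f : R[i] -> R[i]] is handled through the two real functions
   [repart f] and [impart f] on the plane. *)

Section complex_plane.
Variable R : realType.
Implicit Types (f g u phi : R[i] -> R[i]) (h : R * R -> R).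

Definition toC (p : R * R) : R[i] := p.1 +i* p.2.
Definition ofC (z : R[i]) : R * R := (complex.Re z, complex.Im z).

Definition repart f (p : R * R) : R := complex.Re (f (toC p)).
Definition impart f (p : R * R) : R := complex.Im (f (toC p)).

Local Notation area :=
  ((@lebesgue_measure R) \x (@lebesgue_measure R))%E.

(* Borel rather than Lebesgue measurability; this does not change [L2] below,
   since a Lebesgue measurable function is a.e. equal to a Borel one. *)
Definition cmeasurable f : Prop :=
  measurable_fun [set: measurableTypeR R * measurableTypeR R] (repart f) /\
  measurable_fun [set: measurableTypeR R * measurableTypeR R] (impart f).

Definition cintegral f : R[i] :=
  (\int[area]_p repart f p) +i* (\int[area]_p impart f p).

Definition partial_x h (p : R * R) : R := 'D_((1, 0) : R * R) h p.
Definition partial_y h (p : R * R) : R := 'D_((0, 1) : R * R) h p.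

Fixpoint Cn (n : nat) h : Prop :=
  continuous h /\
  match n with
  | 0%N => True
  | m.+1 => [/\ forall p, derivable h p ((1, 0) : R * R),
                forall p, derivable h p ((0, 1) : R * R),
                Cn m (partial_x h) & Cn m (partial_y h)]
  end.

Definition csmooth f : Prop := forall n, Cn n (repart f) /\ Cn n (impart f).

Definition test_function phi : Prop :=
  csmooth phi /\ compact (closure [set p : R * R | phi (toC p) != 0]).

Definition cpartial_x f (z : R[i]) : R[i] :=
  partial_x (repart f) (ofC z) +i* partial_x (impart f) (ofC z).
Definition cpartial_y f (z : R[i]) : R[i] :=
  partial_y (repart f) (ofC z) +i* partial_y (impart f) (ofC z).

Definition dbar f (z : R[i]) : R[i] :=
  2^-1 * (cpartial_x f z + 'i%C * cpartial_y f z).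

Definition weak_dbar (k : nat) u g : Prop :=
  forall phi, test_function phi ->
    cintegral (fun z => u z * iter k dbar phi z) =
    (-1) ^+ k * cintegral (fun z => g z * phi z).

Definition weak_solution (k : nat) (a : R[i]) f u : Prop :=
  weak_dbar k u (fun z => f z - a * u z).

Definition L2loc f : Prop :=
  cmeasurable f /\
  forall K : set (R * R), compact K ->
    (\int[area]_(p in K) (Normc.normc (f (toC p)) ^+ 2)%:E < +oo)%E.

Definition wsqnorm f : \bar R :=
  (\int[area]_p
     (Normc.normc (f (toC p)) ^+ 2 * expR (- Normc.normc (toC p) ^+ 2))%:E)%E.

Definition wnorm f : R := Num.sqrt (fine (wsqnorm f)).

Definition L2w : {pred R[i] -> R[i]} :=
  mem [set f | L2loc f /\ (wsqnorm f < +oo)%E].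

Lemma open_area_measurable (A : set (R * R)) : open A ->
  measurable (A : set (measurableTypeR R * measurableTypeR R)).
Proof.
move=> oA.
pose box (q : rat * rat * (rat * rat)) : set (R * R) :=
  `]ratr q.1.1, ratr q.1.2[%classic `*` `]ratr q.2.1, ratr q.2.2[%classic.
have -> : A = \bigcup_(q in [set q | box q `<=` A]) box q.
  apply/seteqP; split => [[x y] Axy|p [q /= qA]]; last exact: qA.
  have /nbhs_ballP[e /= e0 eA] : nbhs (x, y) A by exact: open_nbhs_nbhs.
  have rr (t : R) : exists q : rat * rat,
      [/\ t - e < ratr q.1, ratr q.1 < t, t < ratr q.2 & ratr q.2 < t + e].
    have /rat_in_itvoo[q1] : t - e < t by rewrite ltrBlDr ltrDl.
    rewrite inE/= => /itvP h1.
    have /rat_in_itvoo[q2] : t < t + e by rewrite ltrDl.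
    rewrite inE/= => /itvP h2.
    by exists (q1, q2); rewrite /= !(h1, h2).
  have [q [q1 q2 q3 q4]] := rr x; have [r [r1 r2 r3 r4]] := rr y.
  exists (q, r); last by split; rewrite /= in_itv/= ?q2 ?q3 ?r2 ?r3.
  move=> [s t] [/=]; rewrite !in_itv/= => /andP[s1 s2] /andP[t1 t2].
  by apply: eA; split; rewrite /ball/= ltr_distlC;
    apply/andP; split; (apply: lt_trans; [eassumption|]) => //;
    apply: lt_trans; eassumption.
rewrite bigcup_mkcond; apply: countable_bigcupT_measurable => // q.
by case: ifPn => // _; apply: measurableX; exact: measurable_itv.
Qed.

Lemma compact_area_measurable (K : set (R * R)) : compact K ->
  measurable (K : set (measurableTypeR R * measurableTypeR R)).
Proof.
move=> cK; rewrite -[K]setCK; apply: measurableC.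
apply: open_area_measurable; apply: closed_openC.
by apply: compact_closed => //; exact: norm_hausdorff.
Qed.

Let T : measurableType _ := (measurableTypeR R * measurableTypeR R)%type.

Lemma measurable_normc2 f : cmeasurable f ->
  measurable_fun [set: T] (fun p => Normc.normc (f (toC p)) ^+ 2).
Proof.
move=> [mr mi].
have -> : (fun p : T => Normc.normc (f (toC p)) ^+ 2) =
    (fun p => repart f p ^+ 2 + impart f p ^+ 2).
  apply/funext => p; rewrite /repart /impart; case: (f _) => x y /=.
  by rewrite sqr_sqrtr// addr_ge0 ?sqr_ge0.
by apply: measurable_funD; exact: measurable_funX.
Qed.

Lemma normc2_lin_le (a x y : R[i]) :
  Normc.normc (a * x + y) ^+ 2 <=
  2 * Normc.normc a ^+ 2 * Normc.normc x ^+ 2 + 2 * Normc.normc y ^+ 2.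
Proof.
have n0 (z : R[i]) : 0 <= Normc.normc z by case: z => u v; exact: sqrtr_ge0.
have := le_normcD (a * x) y; rewrite Normc.normcM.
move: (n0 (a * x + y)) (n0 a) (n0 x) (n0 y).
set n := Normc.normc (_ + _); set A := Normc.normc a.
set X := Normc.normc x; set Y := Normc.normc y => n_ge0 A0 X0 Y0 le_n.
have le2 : n ^+ 2 <= (A * X + Y) ^+ 2.
  by rewrite lerXn2r// nnegrE ?addr_ge0 ?mulr_ge0.
apply: (le_trans le2); rewrite -subr_ge0.
have -> : 2 * A ^+ 2 * X ^+ 2 + 2 * Y ^+ 2 - (A * X + Y) ^+ 2 =
          (A * X - Y) ^+ 2 by ring.
exact: sqr_ge0.
Qed.

Lemma cmeasurable_lin (a : R[i]) f g : cmeasurable f -> cmeasurable g ->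
  cmeasurable (a *: f + g).
Proof.
move=> [mfr mfi] [mgr mgi]; case: a => x y; split.
- have -> : repart ((x +i* y) *: f + g) =
      (fun p => x * repart f p - y * impart f p + repart g p).
    apply/funext => p; rewrite /repart /impart /=.
    rewrite /GRing.scale/= /GRing.mul/= /GRing.add/=.
    by case: (f _) => ? ?; case: (g _).
  by apply: measurable_funD => //; apply: measurable_funB;
    exact: measurable_funM.
- have -> : impart ((x +i* y) *: f + g) =
      (fun p => x * impart f p + y * repart f p + impart g p).
    apply/funext => p; rewrite /repart /impart /=.
    rewrite /GRing.scale/= /GRing.mul/= /GRing.add/=.
    by case: (f _) => ? ?; case: (g _).
  by apply: measurable_funD => //; apply: measurable_funD;
    exact: measurable_funM.
Qed.

Lemma wint_lin (D : set T) (w : T -> R) (a : R[i]) f g :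
  measurable D -> measurable_fun [set: T] w -> (forall p, 0 <= w p) ->
  cmeasurable f -> cmeasurable g ->
  (\int[area]_(p in D) (Normc.normc (f (toC p)) ^+ 2 * w p)%:E < +oo)%E ->
  (\int[area]_(p in D) (Normc.normc (g (toC p)) ^+ 2 * w p)%:E < +oo)%E ->
  (\int[area]_(p in D)
     (Normc.normc ((a *: f + g) (toC p)) ^+ 2 * w p)%:E < +oo)%E.
Proof.
move=> mD mw w0 mf mg ff fg.
have m2 f1 : cmeasurable f1 -> measurable_fun D
    (fun p => (Normc.normc (f1 (toC p)) ^+ 2 * w p)%:E).
  move=> mf1; apply/measurable_EFinP; apply: measurable_funTS.
  by apply: measurable_funM => //; exact: measurable_normc2.
have p0 f1 p : (0 <= (Normc.normc (f1 (toC p)) ^+ 2 * w p)%:E)%E.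
  by rewrite lee_fin mulr_ge0 ?sqr_ge0.
pose c := 2 * Normc.normc a ^+ 2.
have c0 : 0 <= c by rewrite mulr_ge0 ?sqr_ge0.
apply: (@le_lt_trans _ _ (\int[area]_(p in D)
    (c%:E * (Normc.normc (f (toC p)) ^+ 2 * w p)%:E +
     2%:E * (Normc.normc (g (toC p)) ^+ 2 * w p)%:E))%E).
  apply: ge0_le_integral => //.
  - by apply: m2; exact: cmeasurable_lin.
  - by apply: emeasurable_funD; apply: measurable_funeM; exact: m2.
  - move=> p _; rewrite -!EFinM -EFinD lee_fin.
    rewrite (mulrA c) (mulrA 2) -mulrDl ler_wpM2r//.
    exact: normc2_lin_le.
rewrite ge0_integralD//; last 4 first.
- by move=> p _; rewrite mule_ge0.
- by apply: measurable_funeM; exact: m2.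
- by move=> p _; rewrite mule_ge0.
- by apply: measurable_funeM; exact: m2.
rewrite !ge0_integralZl//; [|exact: m2|exact: m2].
by rewrite lte_add_pinfty// lte_mul_pinfty.
Qed.

Lemma cmeasurable0 : cmeasurable 0.
Proof. by split; exact: measurable_cst. Qed.

Let wint0 (D : set T) (w : T -> R) :
  (\int[area]_(p in D)
     (Normc.normc ((0 : R[i] -> R[i]) (toC p)) ^+ 2 * w p)%:E < +oo)%E.
Proof.
rewrite (eq_integral (cst 0%E)) ?integral0// => p _.
by rewrite [X in X ^+ 2]Normc.normc0 expr0n mul0r.
Qed.

Lemma measurable_weight :
  measurable_fun [set: T] (fun p => expR (- Normc.normc (toC p) ^+ 2)).
Proof.
apply: measurableT_comp => //; apply: measurableT_comp => //.
apply: (@measurable_normc2 id).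
by split; [exact: measurable_fst|exact: measurable_snd].
Qed.

Lemma L2w_submod_closed : submod_closed L2w.
Proof.
split.
  rewrite inE; split; last exact: wint0.
  split; first exact: cmeasurable0.
  by move=> K _; under eq_integral do rewrite -[X in X%:E]mulr1; exact: wint0.
move=> a f g /[!inE] -[[mf lf] ff] [[mg lg] fg]; split.
  split; first exact: cmeasurable_lin.
  move=> K cK; under eq_integral do rewrite -[X in X%:E]mulr1.
  apply: wint_lin => //.
  - exact: compact_area_measurable.
  - by under eq_integral do rewrite mulr1; exact: lf.
  - by under eq_integral do rewrite mulr1; exact: lg.
by apply: wint_lin => //; exact: measurable_weight.
Qed.

HB.instance Definition _ :=
  GRing.isSubmodClosed.Build _ _ L2w L2w_submod_closed.

Record L2fun := MkL2fun {
  L2fun_val :> R[i] -> R[i];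
  _ : L2fun_val \in L2w }.

HB.instance Definition _ := [isSub for L2fun_val].
HB.instance Definition _ := [Choice of L2fun by <:].
HB.instance Definition _ := [SubChoice_isSubLmodule of L2fun by <:].

Definition L2null : {pred L2fun} :=
  mem [set f : L2fun | {ae area, forall p, f (toC p) = 0}].

Lemma L2null_submod_closed : submod_closed L2null.
Proof.
split; first by rewrite inE; exact/nearW.
move=> a f g /[!inE] f0 g0.
have F := ae_filter_ringOfSetsType area.
apply: (filterS2 _ _ f0 g0) => p {}f0 {}g0.
have -> : (a *: f + g) (toC p) = a * f (toC p) + g (toC p) by [].
by rewrite f0 g0 mulr0 addr0.
Qed.

HB.instance Definition _ :=
  GRing.isSubmodClosed.Build _ _ L2null L2null_submod_closed.

(* Square-integrable functions modulo a.e. equality, see [L2_eqP]. *)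
Definition L2 : Type := {ideal_quot L2null}.

HB.instance Definition _ := GRing.Zmodule.on L2.
HB.instance Definition _ := EqQuotient.on L2.

Local Open Scope quotient_scope.

Lemma L2_eqP (f g : L2fun) :
  reflect {ae area, forall p, f (toC p) = g (toC p)}
    (\pi_L2 f == \pi_L2 g).
Proof.
have F := ae_filter_ringOfSetsType area.
rewrite piE Quotient.equivE; apply: (iffP idP) => [/[!inE]|] fg.
  by apply: filterS fg => p /eqP; rewrite subr_eq0 => /eqP.
by rewrite inE; apply: filterS fg => p /eqP; rewrite -subr_eq0 => /eqP.
Qed.

Definition L2scale (c : R[i]) (u : L2) : L2 := \pi_L2 (c *: repr u).

Lemma pi_L2scale c : {morph \pi_L2 : f / c *: f >-> L2scale c f}.
Proof.
move=> f; apply/eqP; rewrite /L2scale piE Quotient.equivE -scalerBr.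
by apply: rpredZ; rewrite Quotient.idealrBE; apply/eqP; rewrite reprK.
Qed.

Lemma pi_L2add : {morph \pi_L2 : f g / f + g}.
Proof. exact: Quotient.pi_add. Qed.

Let L2scaleA (a b : R[i]) (u : L2) :
  L2scale a (L2scale b u) = L2scale (a * b) u.
Proof.
elim/quotW: u => f.
by rewrite -(pi_L2scale b f) -pi_L2scale -(pi_L2scale (a * b) f) scalerA.
Qed.

Let L2scale1 : left_id 1 L2scale.
Proof. by elim/quotW => f; rewrite -pi_L2scale scale1r. Qed.

Let L2scaleDr : right_distributive L2scale +%R.
Proof.
move=> c; elim/quotW => f; elim/quotW => g.
by rewrite -pi_L2add -(pi_L2scale c f) -(pi_L2scale c g) -pi_L2add -pi_L2scale
           scalerDr.
Qed.

Let L2scaleDl (u : L2) : {morph L2scale^~ u : a b / a + b}.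
Proof.
elim/quotW: u => f a b.
by rewrite -(pi_L2scale a f) -(pi_L2scale b f) -pi_L2add -pi_L2scale scalerDl.
Qed.

HB.instance Definition _ := GRing.Zmodule_isLmodule.Build R[i] L2
  L2scaleA L2scale1 L2scaleDr L2scaleDl.

Definition L2_repr (u : L2) : R[i] -> R[i] := repr u.
Coercion L2_repr : L2 >-> Funclass.

Lemma L2_repr_pi (f : L2fun) :
  {ae area, forall p, L2_repr (\pi_L2 f) (toC p) = f (toC p)}.
Proof. by apply/L2_eqP; rewrite reprK. Qed.

Definition L2norm (u : L2) : R := wnorm u.

Lemma L2norm_pi (f : L2fun) : L2norm (\pi_L2 f) = wnorm f.
Proof.
have mw (g : L2fun) : measurable_fun [set: T] (fun p =>
    (Normc.normc (g (toC p)) ^+ 2 * expR (- Normc.normc (toC p) ^+ 2))%:E).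
  have /[!inE] -[[mg _] _] := valP g; apply/measurable_EFinP.
  by apply: measurable_funM; [exact: measurable_normc2|exact: measurable_weight].
rewrite /L2norm /wnorm /wsqnorm; congr (Num.sqrt (fine _)).
have F := ae_filter_ringOfSetsType area.
apply: ge0_ae_eq_integral => //.
- exact: (mw (repr (\pi_L2 f))).
- by move=> p _; rewrite lee_fin mulr_ge0 ?sqr_ge0 ?expR_ge0.
- by move=> p _; rewrite lee_fin mulr_ge0 ?sqr_ge0 ?expR_ge0.
- by apply: filterS (L2_repr_pi f) => p /= -> _.
Qed.

Definition bounded_operator (A : L2 -> L2) : Prop :=
  exists M : R, forall u : L2, L2norm (A u) <= M * L2norm u.

(* Valued in [\bar R] so that the supremum of an unbounded set is [+oo], not
   the default value of [sup]. *)
Definition operator_norm (A : L2 -> L2) : \bar R :=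
  ereal_sup [set (L2norm (A u))%:E | u in [set u : L2 | L2norm u <= 1]].

End complex_plane.

(* Main.v *)
Require Import Defs.
From HB Require Import structures.
From mathcomp Require Import all_boot all_order all_algebra.
From mathcomp Require Import generic_quotient complex.
From mathcomp Require Import all_classical all_reals all_analysis.
From mathcomp Require Import measurable_realfun ring lra zify.

(** The theorem follows from an a priori estimate for the adjoint of
    [dbar^k + a], in the manner of Hoermander's L^2 method.

    Integration of [u] against a test function [phi] is the inner product, in
    the space weighted by [exp (- |z|^2)], of [u] with
    [dual_of phi = exp (|z|^2) * conj phi] ([pairing_dual]).  Hence [u] is a
    weak solution of [dbar^k u + a u = f] exactly when
    [<u, dual_of (adjoint phi)> = <f, dual_of phi>] for all test functions
    [phi], where [adjoint phi = (-dbar)^k phi + a phi]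
    ([weak_solution_of_adjoint]).  If [k! |dual_of phi|^2] is at most
    [|dual_of (adjoint phi)|^2], the right-hand side depends on
    [dual_of (adjoint phi)] alone, as a functional of norm at most
    [|f| / sqrt k!], and it is represented by a unique [u] in the closure of
    these vectors.  Uniqueness makes [u] depend linearly on [f]
    ([coercive_graph_operator]).  Representing the functional requires
    completeness of the weighted space ([L2_fast_complete]), which comes from
    [riesz_fischer].

    The norm of [dual_of phi] is the norm of [phi] in the space weighted by
    [exp (|z|^2)].  There the operator [A = - dbar] has the adjoint
    [C = d/dz + conj z] by integration by parts ([energy_adjoint]), and
    [C A - A C = 1] ([commutator]), a relation that rests on the symmetry of
    second derivatives ([partial_comm]).  So [A] and [C] are the creation and
    annihilation operators of a harmonic oscillator.  Commuting them gives
    [|A^k phi|^2 >= |C^k phi|^2 + k! |phi|^2] ([norm_iterC_iterA]).  Since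
    [<A^k phi, a phi>] and [<C^k phi, conj a phi>] have the same real part, the
    constant term cancels between the two squares:
    [|A^k phi + a phi|^2 >= |C^k phi + conj a phi|^2 + k! |phi|^2]
    ([weyl_coercive]).  This is why the bound does not involve [a]. *)

Set Implicit Arguments.
Unset Strict Implicit.
Unset Printing Implicit Defensive.

Import Order.TTheory GRing.Theory Num.Theory.
Import numFieldNormedType.Exports.

Local Open Scope classical_set_scope.
Local Open Scope ring_scope.

(** * Coercive linear relations in a Hilbert space *)

(** [B] is the real part of a complex inner product.  The complex structure is
    remembered by [Bconj] alone: multiplication by [c] is adjoint to multiplication
    by its conjugate. *)
Section riesz.
Variables (R : realType) (V : lmodType R[i]) (B : V -> V -> R).

(** Only sequences with steps at most [2^-n] are required to converge: a
    minimising sequence can be chosen to be such, and in L^2 these are the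
    sequences that converge almost everywhere without extraction. *)
Definition fast_complete := forall x : nat -> V,
  (forall n, B (x n.+1 - x n) (x n.+1 - x n) <= (4 ^+ n)^-1) ->
  exists u, forall e : R, 0 < e ->
    exists N, forall n, (N <= n)%N -> B (u - x n) (u - x n) < e.

Hypothesis BDl : forall u v w, B (u + v) w = B u w + B v w.
Hypothesis BC : forall u v, B u v = B v u.
Hypothesis BZ : forall (t : R) u v, B (t%:C%C *: u) v = t * B u v.
Hypothesis Bconj : forall (c : R[i]) u v, B (c *: u) v = B u (c^*%C *: v).
Hypothesis B_ge0 : forall u, 0 <= B u u.
Hypothesis B_eq0 : forall u, B u u = 0 -> u = 0.
Hypothesis B_complete : fast_complete.

Local Notation N u := (B u u).

Let BDr u v w : B u (v + w) = B u v + B u w.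
Proof. by rewrite BC BDl !(BC _ u). Qed.

Let BZr (t : R) u v : B u (t%:C%C *: v) = t * B u v.
Proof. by rewrite BC BZ BC. Qed.

Let BNl u v : B (- u) v = - B u v.
Proof.
have -> : - u = (-1 : R)%:C%C *: u by rewrite rmorphN rmorph1 scaleN1r.
by rewrite BZ mulN1r.
Qed.

Let BNr u v : B u (- v) = - B u v.
Proof. by rewrite BC BNl BC. Qed.

Let BE := (BDl, BDr, BNl, BNr, BZ, BZr).

Lemma inner_CS u v : B u v ^+ 2 <= N u * N v.
Proof.
have [v0|v0] := eqVneq (N v) 0.
  by rewrite (B_eq0 v0) -(scale0r (0 : V)) (_ : 0 = (0 : R)%:C%C) // BZr mul0r
             expr0n /= mulr_ge0.
have vpos : 0 < N v by rewrite lt_neqAle eq_sym v0 B_ge0.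
have := B_ge0 ((N v)%:C%C *: u - (B u v)%:C%C *: v).
rewrite !BE (BC v u) => h.
rewrite -subr_ge0 -(pmulr_rge0 _ vpos).
apply: le_trans h _; rewrite le_eqVlt; apply/orP; left; apply/eqP; ring.
Qed.

Lemma inner_sub_le u v : N (u - v) <= 2 * N u + 2 * N v.
Proof. by have := B_ge0 (u + v); rewrite !BE (BC v u); lra. Qed.

Lemma inner_normZ c u : N (c *: u) = Normc.normc c ^+ 2 * N u.
Proof.
rewrite Bconj scalerA -BZr; congr (B _ (_ *: _)).
case: c => x y; rewrite sqr_sqrtr ?addr_ge0 ?sqr_ge0 //.
by apply/eqP; rewrite eq_complex /=; apply/andP; split; apply/eqP; ring.
Qed.

Section graph.
Variables (G : V -> V -> Prop) (C : R).
Hypothesis C_gt0 : 0 < C.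
Hypothesis G0 : G 0 0.
Hypothesis G_lin : forall c x y x' y', G x y -> G x' y' ->
  G (c *: x + x') (c *: y + y').
Hypothesis G_coercive : forall x y, G x y -> C * N y <= N x.

Let GZ c x y : G x y -> G (c *: x) (c *: y).
Proof. by move=> g; have := G_lin c g G0; rewrite !addr0. Qed.

Let GD x y x' y' : G x y -> G x' y' -> G (x + x') (y + y').
Proof. by move=> g g'; have := G_lin 1 g g'; rewrite !scale1r. Qed.

(** The second clause places [u] in the closure of the first components of [G],
    without which [u] would be determined only up to a vector orthogonal to them. *)
Definition solves f u := (forall x y, G x y -> B u x = B f y) /\
  forall e : R, 0 < e -> exists x y, G x y /\ N (u - x) < e.

(** Young's inequality with weight [C].  It bounds from below the functional
    minimised in [solves_exists], and yields the norm bound of [solves_bound]. *)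
Lemma coercive_pairing f x y : G x y -> 2 * B f y <= N x + N f / C.
Proof.
move=> /G_coercive h.
have := B_ge0 (C%:C%C *: y - f); rewrite !BE (BC y f) => h2.
have -> : N x + N f / C = (C * N x + N f) / C.
  by rewrite mulrDl mulrAC divff ?mul1r // gt_eqF.
rewrite ler_pdivlMr //.
have : C * (C * N y) <= C * N x by rewrite ler_pM2l.
lra.
Qed.

Lemma solves_bound f u : solves f u -> C * N u <= N f.
Proof.
move=> [sol app]; rewrite mulrC -ler_pdivlMr //; apply/ler_addgt0Pl => e e0.
have [x [y [Gxy xe]]] := app _ e0.
have := coercive_pairing f Gxy; rewrite -(sol _ _ Gxy).
by move: xe; rewrite !BE (BC x u); lra.
Qed.

(** The difference of two solutions is orthogonal to the first components of [G]
    and is a limit of such components. *)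
Lemma solves_uniq f u u' : solves f u -> solves f u' -> u = u'.
Proof.
move=> [s1 a1] [s2 a2]; apply/eqP; rewrite -subr_eq0; apply/eqP; apply: B_eq0.
apply/eqP; rewrite eq_le B_ge0 andbT; apply/ler_addgt0Pl => e e0.
have e4 : 0 < e / 4 by rewrite divr_gt0.
have [x [y [Gx xe]]] := a1 _ e4; have [x' [y' [Gx' xe']]] := a2 _ e4.
have o1 : B (u - u') x = 0 by rewrite !BE (s1 _ _ Gx) (s2 _ _ Gx) subrr.
have o2 : B (u - u') x' = 0 by rewrite !BE (s1 _ _ Gx') (s2 _ _ Gx') subrr.
have := inner_sub_le (u - x) (u' - x'); have := B_ge0 (x - x').
have -> : u - x - (u' - x') = (u - u') - (x - x').
  by rewrite [- (u' - x')]opprD addrACA -opprD.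
rewrite [N (u - u' - _)](_ : _ = N (u - u') + N (x - x')); last first.
  move: o1 o2; rewrite !BE !(BC x u) !(BC x u') !(BC x' u) !(BC x' u') => o1 o2.
  lra.
by lra.
Qed.

Lemma solves_lin c f u f' u' : solves f u -> solves f' u' ->
  solves (c *: f + f') (c *: u + u').
Proof.
move=> [s1 a1] [s2 a2]; split.
  move=> x y Gxy; rewrite !BDl !(Bconj c) (s2 _ _ Gxy); congr (_ + _).
  exact/s1/GZ.
move=> e e0.
have n0 : 0 <= Normc.normc c ^+ 2 by exact: sqr_ge0.
pose K := 2 * Normc.normc c ^+ 2 + 2.
have K0 : 0 < K by rewrite /K; lra.
have eK : 0 < e / K by rewrite divr_gt0.
have [x [y [Gx xe]]] := a1 _ eK; have [x' [y' [Gx' xe']]] := a2 _ eK.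
exists (c *: x + x'), (c *: y + y'); split; first exact: G_lin.
have -> : c *: u + u' - (c *: x + x') = c *: (u - x) - (x' - u').
  by rewrite scalerBr opprB opprD addrACA.
apply: le_lt_trans (inner_sub_le _ _) _.
rewrite inner_normZ -(opprB u') BNl BNr opprK.
have -> : e = 2 * (Normc.normc c ^+ 2 * (e / K)) + 2 * (e / K).
  rewrite -[e in LHS](@divfK _ K) ?gt_eqF //; rewrite /K; ring.
have := ler_wpM2l n0 (ltW xe); lra.
Qed.

Lemma quadratic_discriminant (q b e : R) : 0 <= q ->
  (forall t, 0 <= t ^+ 2 * q + t * b *+ 2 + e) -> b ^+ 2 <= e * q.
Proof.
move=> q0 h; have [q00|qn0] := eqVneq q 0.
  have [->|b0] := eqVneq b 0; first by rewrite q00 expr0n mulr0.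
  have := h (- (e + 1) / (2 * b)); rewrite q00 mulr0 add0r.
  have -> : - (e + 1) / (2 * b) * b *+ 2 + e = -1 by rewrite -mulr_natl; field.
  lra.
have qpos : 0 < q by rewrite lt_neqAle eq_sym qn0.
have := h (- b / q).
have -> : (- b / q) ^+ 2 * q + - b / q * b *+ 2 + e = (e * q - b ^+ 2) / q.
  by rewrite -mulr_natl; field.
by rewrite pmulr_lge0 ?invr_gt0 // subr_ge0.
Qed.

(** The Riesz representation by minimisation of [J = |x|^2 - 2 B(f, y)] over the
    graph itself.  By the parallelogram law a minimising sequence is Cauchy in its
    first component.  Perturbing it along [(x, y)] gives a quadratic polynomial that
    is nonnegative up to a small error, so its linear coefficient
    [B(x_n, x) - B(f, y)] tends to [0]. *)
Lemma solves_exists f : exists u, solves f u.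
Proof.
pose J x y := N x - 2 * B f y.
pose S := [set J p.1 p.2 | p in [set p | G p.1 p.2]].
have Sne : S !=set0 by exists (J 0 0); exists (0, 0).
have Slb : has_lbound S.
  exists (- (N f / C)) => _ [[x y] /= g <-]; rewrite /J.
  by have := coercive_pairing f g; lra.
pose m := inf S.
have mle x y : G x y -> m <= J x y.
  by move=> g; apply: ge_inf => //; exists (x, y).
(* With these excesses over the infimum, [half] gives steps of square at most
   [2 * (eps n + eps n.+1) <= 4^-n]. *)
pose eps n : R := (4 ^+ n.+1)^-1.
have eps0 n : 0 < eps n by rewrite invr_gt0 exprn_gt0.
have /choice[s sP] n : exists p : V * V, G p.1 p.2 /\ J p.1 p.2 < m + eps n.
  have [_ [p g <-] pe] := inf_adherent (eps0 n) (conj Sne Slb).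
  by exists p.
have half x y x' y' : G x y -> G x' y' ->
    N (x - x') <= 2 * (J x y - m) + 2 * (J x' y' - m).
  move=> g g'; have := mle _ _ (GZ (2^-1 : R)%:C%C (GD g g')).
  by rewrite /J !BE (BC x' x); lra.
have fast n : N ((s n.+1).1 - (s n).1) <= (4 ^+ n)^-1.
  have [g1 j1] := sP n; have [g2 j2] := sP n.+1.
  have := half _ _ _ _ g2 g1.
  have e1 : eps n = (4 ^+ n)^-1 / 4 by rewrite /eps exprSr invfM.
  have e2 : eps n.+1 = eps n / 4 by rewrite {1}/eps exprSr invfM.
  have := eps0 n; rewrite e1 in j1 e2 *; rewrite e2 in j2; lra.
have [u uP] := B_complete fast.
exists u; split; last first.
  move=> e /uP[M /(_ M (leqnn _)) h]; exists (s M).1, (s M).2; split=> //.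
  by have [] := sP M.
move=> x y g; apply/eqP; rewrite -subr_eq0 -sqrf_eq0 eq_le sqr_ge0 andbT.
apply/ler_addgt0Pl => e e0; rewrite addr0.
(* The summand [1] keeps [d] finite when [x] is null. *)
pose d := e / (4 * (N x + 1)).
have Nx1 : 0 < N x + 1 by have := B_ge0 x; lra.
have d0 : 0 < d by rewrite divr_gt0 // mulr_gt0.
have de : 4 * d * N x <= e.
  have -> : 4 * d * N x = e * (N x / (N x + 1)).
    by rewrite /d; field; rewrite gt_eqF.
  by rewrite ger_pMr // ler_pdivrMr // mul1r lerDl.
have [M uM] := uP _ d0.
have [M' /(_ (maxn M M')) eM] : exists M', forall n, (M' <= n)%N -> eps n < d.
  have /cvgr0Pnorm_lt/(_ _ d0)[M' _ h] : (fun n => (4^-1 : R) ^+ n) @ \oo --> (0 : R).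
    by apply: cvg_expr; rewrite ger0_norm // invf_lt1 // ltr1n.
  exists M' => n Mn; have := h n.+1 (leqW Mn).
  by rewrite /= exprVn gtr0_norm // -/(eps n) ?eps0.
move/(_ (leq_maxr _ _)) in eM; move: eM.
have {uM} := uM _ (leq_maxl M M'); set n := maxn _ _ => uM eM.
have [gn jn] := sP n; set xn := (s n).1 in uM gn jn *; set yn := (s n).2 in gn jn.
have disc : (B xn x - B f y) ^+ 2 <= eps n * N x.
  apply: quadratic_discriminant => // t.
  have := mle _ _ (GD gn (GZ t%:C%C g)); move: jn; rewrite /J !BE (BC x xn).
  rewrite -mulr_natl expr2 => h1 h2; lra.
have cs := inner_CS (u - xn) x.
have -> : B u x - B f y = B (u - xn) x + (B xn x - B f y) by rewrite !BE; ring.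
have sq (a b : R) : (a + b) ^+ 2 <= 2 * a ^+ 2 + 2 * b ^+ 2.
  by rewrite -subr_ge0; have -> : 2 * a ^+ 2 + 2 * b ^+ 2 - (a + b) ^+ 2 =
    (a - b) ^+ 2 by [ring]; exact: sqr_ge0.
apply: le_trans (sq _ _) _; apply: le_trans de.
have := ler_wpM2r (B_ge0 x) (ltW uM); have := ler_wpM2r (B_ge0 x) (ltW eM).
lra.
Qed.

(** If [G] is seen as an operator taking [y] to [x], then [T] is a right inverse of
    its adjoint.  It is linear because [solves] is a linear relation that determines
    [u]. *)
Lemma coercive_graph_operator : exists T : {linear V -> V}, forall f,
  C * N (T f) <= N f /\ forall x y, G x y -> B (T f) x = B f y.
Proof.
have /choice[T TP] := solves_exists.
have linT : linear T.
  by move=> c f g; apply: solves_uniq (TP _) (solves_lin _ _ _).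
pose L := GRing.isLinear.Build R[i] V V *:%R T linT.
pose TL : {linear V -> V} := HB.pack T L.
by exists TL => f; split; [exact: solves_bound (TP f)|exact: (TP f).1].
Qed.

End graph.
End riesz.

(** * Completeness of the space of square integrable functions *)

Section square_integrable.
Context d (T : measurableType d) (R : realType) (mu : {measure set T -> \bar R}).
Implicit Types (g : nat -> T -> R).

(** The increments [h_m] are summable because
    [|h_m| <= 2^-m + 2^m * h_m^2]. *)
Lemma cvg_of_weighted_squares (u : nat -> R) :
  (\sum_(0 <= m <oo) (2 ^+ m * (u m.+1 - u m) ^+ 2)%:E < +oo)%E -> cvgn u.
Proof.
set v := fun m => 2 ^+ m * (u m.+1 - u m) ^+ 2 => fin.
have v0 m : 0 <= v m by rewrite mulr_ge0 ?sqr_ge0 ?exprn_ge0.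
have cv : cvgn (series v).
  apply: nondecreasing_is_cvgn; first exact: nondecreasing_series.
  exists (fine (\sum_(0 <= m <oo) (v m)%:E)%E) => _ [n _ <-].
  rewrite -lee_fin fineK; last first.
    by rewrite ge0_fin_numE // nneseries_ge0 // => m _ _; rewrite lee_fin.
  rewrite /series /= -sumEFin; apply: nneseries_lim_ge => m _ _.
  by rewrite lee_fin.
have cg : cvgn (series (geometric (1 : R) 2^-1)).
  by apply: is_cvg_geometric_series; rewrite ger0_norm // invf_lt1 // ltr1n.
have ct : cvgn [normed series (telescope u)].
  apply: (@series_le_cvg _ _ (geometric (1 : R) 2^-1 + v)) => [m|m|m|].
  - exact: normr_ge0.
  - by rewrite addr_ge0 //= mul1r exprn_ge0.
  - rewrite /v /telescope /= /GRing.add /= mul1r exprVn; set a : R := 2 ^+ m.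
    set b := u m.+1 - u m.
    have a0 : 0 < a by rewrite exprn_gt0.
    have := sqr_ge0 (a * `|b| - 1).
    rewrite -(real_normK (num_real b)) -(pmulr_rge0 _ a0) => h.
    rewrite -subr_ge0.
    have -> : a^-1 + a * `|b| ^+ 2 - `|b| =
        a^-1 * ((a * `|b| - 1) ^+ 2 + a * `|b|) by field; rewrite gt_eqF.
    by rewrite mulr_ge0 ?invr_ge0 ?addr_ge0 ?sqr_ge0 ?mulr_ge0 // ltW.
  - by rewrite seriesD; apply: is_cvgD.
have -> : u = cst (u 0) \+ series (telescope u).
  by apply/funext => n; rewrite /= -eq_sum_telescope.
by apply: is_cvgD; [exact: is_cvg_cst|exact: normed_cvg].
Qed.

(** The inequality [(a + b)^2 <= 2 a^2 + 2 b^2] doubles the bound at each step,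
    and the factor [1/4] gained from [n] to [n + 1] absorbs this:
    [2 + 2 * 4 / 4 = 4]. *)
Lemma fast_cauchy_tail g : (forall n, measurable_fun [set: T] (g n)) ->
  (forall n, \int[mu]_x ((g n.+1 x - g n x) ^+ 2)%:E <= ((4 ^+ n)^-1)%:E)%E ->
  forall k n,
    (\int[mu]_x ((g (n + k)%N x - g n x) ^+ 2)%:E <= (4 / 4 ^+ n)%:E)%E.
Proof.
move=> mg fast; elim=> [|k IH] n.
  under eq_integral do rewrite addn0 subrr expr0n.
  by rewrite integral0 lee_fin divr_ge0 ?exprn_ge0.
have m2 i j : measurable_fun [set: T] (fun x => ((g i x - g j x) ^+ 2)%:E).
  apply/measurable_EFinP; apply: measurable_funX; exact: measurable_funB.
have p0 i j x : (0 <= ((g i x - g j x) ^+ 2)%:E)%E by rewrite lee_fin sqr_ge0.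
apply: (@le_trans _ _ (\int[mu]_x (2%:E * ((g n.+1 x - g n x) ^+ 2)%:E +
    2%:E * ((g (n.+1 + k)%N x - g n.+1 x) ^+ 2)%:E)))%E.
  apply: ge0_le_integral => //.
  - by apply: emeasurable_funD; apply: measurable_funeM; exact: m2.
  - move=> x _; rewrite addnS -!EFinM -EFinD lee_fin -addSn -subr_ge0.
    set a := g (_ + _)%N x; set b := g n.+1 x; set c := g n x.
    have -> : 2 * (b - c) ^+ 2 + 2 * (a - b) ^+ 2 - (a - c) ^+ 2 =
      ((b - c) - (a - b)) ^+ 2 by ring.
    exact: sqr_ge0.
rewrite ge0_integralD //; last 4 first.
- by move=> x _; rewrite mule_ge0.
- by apply: measurable_funeM; exact: m2.
- by move=> x _; rewrite mule_ge0.
- by apply: measurable_funeM; exact: m2.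
rewrite !ge0_integralZl //.
have -> : 4 / 4 ^+ n = 2 * (4 ^+ n)^-1 + 2 * (4 / 4 ^+ n.+1) :> R.
  by rewrite exprS; field; rewrite expf_neq0.
rewrite [leRHS]EFinD !EFinM; apply: leeD; apply: lee_pmul => //.
- exact: integral_ge0.
- exact: integral_ge0.
Qed.

(** The sum of [2^m * (g_(m+1) - g_m)^2] has integral at most [2], hence is finite
    almost everywhere, and there [g] converges.  The rate follows from
    [fast_cauchy_tail] by Fatou's lemma. *)
Lemma riesz_fischer g : (forall n, measurable_fun [set: T] (g n)) ->
  (forall n, \int[mu]_x ((g n.+1 x - g n x) ^+ 2)%:E <= ((4 ^+ n)^-1)%:E)%E ->
  exists2 l : T -> R, measurable_fun [set: T] l &
    forall n, (\int[mu]_x ((l x - g n x) ^+ 2)%:E <= (4 / 4 ^+ n)%:E)%E.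
Proof.
move=> mg fast.
have m2 i j : measurable_fun [set: T] (fun x => ((g i x - g j x) ^+ 2)%:E).
  apply/measurable_EFinP; apply: measurable_funX; exact: measurable_funB.
pose v m x : \bar R := (2 ^+ m * (g m.+1 x - g m x) ^+ 2)%:E.
have mv m : measurable_fun [set: T] (v m).
  apply/measurable_EFinP; apply: measurable_funM => //.
  by apply: measurable_funX; exact: measurable_funB.
have v0 m x : (0 <= v m x)%E by rewrite lee_fin mulr_ge0 ?sqr_ge0 ?exprn_ge0.
pose S x : \bar R := (\sum_(0 <= m <oo) v m x)%E.
have S0 x : (0 <= S x)%E by exact: nneseries_ge0.
have mS : measurable_fun [set: T] S.
  exact: ge0_emeasurable_sum.
have iS : (\int[mu]_x S x < +oo)%E.
  rewrite /S integral_nneseries //.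
  apply: (@le_lt_trans _ _ 2%:E); last exact: ltry.
  apply: le_trans (@epsilon_trick0 R 2 xpredT (ler0n _ _)).
  apply: lee_nneseries => [m _ _|m _]; first exact: integral_ge0.
  rewrite natrX /v; under eq_integral do rewrite EFinM.
  rewrite ge0_integralZl ?lee_fin ?exprn_ge0 //; last first.
    by move=> x _; rewrite lee_fin sqr_ge0.
  apply: (@le_trans _ _ ((2 ^+ m)%:E * ((4 ^+ m)^-1)%:E)%E).
    by apply: lee_wpmul2l (fast m); rewrite lee_fin exprn_ge0.
  have -> : 4 = 2 * 2 :> R by rewrite -natrM.
  rewrite -EFinM lee_fin exprMn exprS le_eqVlt; apply/orP; left; apply/eqP.
  by field; rewrite expf_neq0.
have aeS : {ae mu, forall x, cvgn (g ^~ x)}.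
  have /integrable_ae : mu.-integrable [set: T] S.
    apply/integrableP; split => //.
    by under eq_integral do rewrite gee0_abs //.
  move=> /(_ measurableT) aeS.
  have F := ae_filter_ringOfSetsType mu.
  apply: filterS aeS => x /(_ I) Sx; apply: cvg_of_weighted_squares.
  by rewrite -/(S x) -ge0_fin_numE.
(* The limit superior is measurable, and it is the limit where there is one. *)
pose l x := fine (limn_esup (fun n => (g n x)%:E)).
have ml : measurable_fun [set: T] l.
  apply: measurableT_comp => //.
  by apply: measurable_fun_limn_esup => n; exact/measurable_EFinP.
exists l => // n.
apply: (@le_trans _ _ (limn_einf (fun k =>
    \int[mu]_x ((g (n + k)%N x - g n x) ^+ 2)%:E)))%E; last first.
  rewrite limn_einf_lim; apply: lime_le.
    exact: is_cvg_einfs.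
  apply: nearW => k; apply: le_trans (fast_cauchy_tail mg fast k n).
  by apply: ereal_inf_lbound; exists k => //=.
apply: le_trans (fatou mu measurableT _ _) => //; last first.
  by move=> k x _; rewrite lee_fin sqr_ge0.
rewrite le_eqVlt; apply/orP; left; apply/eqP.
apply: ge0_ae_eq_integral => //.
- apply/measurable_EFinP; apply: measurable_funX; exact: measurable_funB.
- rewrite /limn_einf; apply: measurableT_comp => //.
  apply: measurable_fun_limn_esup => k; apply: measurableT_comp => //.
- by move=> x _; rewrite lee_fin sqr_ge0.
- move=> x _; rewrite limn_einf_lim; apply: lime_ge; first exact: is_cvg_einfs.
  by apply: nearW => k; apply: le_ereal_inf_tmp => _ [j _ <-]; rewrite lee_fin sqr_ge0.
- have F := ae_filter_ringOfSetsType mu.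
  apply: filterS aeS => x cx _.
  have lx : l x = limn (g ^~ x).
    rewrite /l is_cvg_limn_esupE; first by rewrite EFin_lim.
    by apply: cvgP; apply: cvg_EFin; [exact: nearW|exact: cx].
  have cl : (fun k => ((g (n + k)%N x - g n x) ^+ 2)%:E) @ \oo -->
      ((l x - g n x) ^+ 2)%:E.
    apply: cvg_EFin; first exact: nearW.
    have cn : (fun k => g (n + k)%N x) @ \oo --> l x.
      have /(cvg_comp _ _ (cvg_addnl n)) : (g ^~ x) @ \oo --> l x by rewrite lx.
      exact.
    have cd : (fun k => g (n + k)%N x - g n x) @ \oo --> l x - g n x.
      by apply: cvgB cn _; exact: cvg_cst.
    rewrite expr2; apply: cvg_trans (cvgM cd cd).
    by apply: near_eq_cvg; apply: nearW => k /=; rewrite expr2.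
  rewrite is_cvg_limn_einfE; first exact/esym/cvg_lim.
  exact: cvgP cl.
Qed.
End square_integrable.

(** * Compactly supported functions on the plane *)

Section plane_calculus.
Variable R : realType.
Implicit Types (h g : R * R -> R) (p : R * R).

Local Notation area := ((@lebesgue_measure R) \x (@lebesgue_measure R))%E.
Local Notation plane := (measurableTypeR R * measurableTypeR R)%type.
Local Notation ex := ((1, 0) : R * R).
Local Notation ey := ((0, 1) : R * R).

(** A support condition that passes to slices and to products at once, unlike
    compactness of the closure of the support. *)
Definition boxed (M : R) h := forall p, M < `|p.1| \/ M < `|p.2| -> h p = 0.

Lemma continuous_plane_measurable h :
  continuous h -> measurable_fun [set: plane] h.
Proof.
move=> ch; apply: (measurability _ (RGenOpens.measurableE R)).
move=> _ [_ [a [b ->] <-]]; rewrite setTI; apply: open_area_measurable.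
by have /continuousP := ch; apply; exact: interval_open.
Qed.

Lemma boxed_bounded M h : continuous h -> boxed M h ->
  exists K, forall p, `|h p| <= K.
Proof.
move=> ch bh.
have cK : compact (`[- `|M|, `|M|] `*` `[- `|M|, `|M|] : set (R * R)).
  by apply: compact_setX; exact: segment_compact.
have /compact_bounded[K [_ /(_ (K + 1))]] := continuous_compact
  (continuous_subspaceT ch) cK.
rewrite ltrDl ltr01 => /(_ isT) hK.
exists (Num.max (K + 1) 0) => p; rewrite le_max.
have [h0|h0] := eqVneq (h p) 0; first by rewrite h0 normr0 lexx orbT.
apply/orP; left; apply: hK; exists p => //; split => /=; rewrite in_itv /= -ler_norml.
  rewrite leNgt; apply/negP => /(le_lt_trans (ler_norm M)) ?.
  by move/eqP: h0; apply; apply: bh; left.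
rewrite leNgt; apply/negP => /(le_lt_trans (ler_norm M)) ?.
by move/eqP: h0; apply; apply: bh; right.
Qed.

Lemma boxed_integrable M h : continuous h -> boxed M h ->
  area.-integrable [set: plane] (EFin \o h).
Proof.
move=> ch bh; have [K hK] := boxed_bounded ch bh.
pose I : set (measurableTypeR R) := `[- `|M|, `|M|]%classic.
have mI : measurable I by exact: measurable_itv.
pose D : set plane := I `*` I.
have mD : measurable D by exact: measurableX.
have -> : EFin \o h = (EFin \o h) \_ D.
  apply/funext => p; rewrite /patch; case: ifPn => // /negP pD /=.
  rewrite bh //; apply: contrapT => /not_orP[/negP h1 /negP h2]; apply: pD.
  rewrite inE; split; rewrite /I /= in_itv /= -ler_norml.
    by rewrite -leNgt in h1; exact: le_trans (ler_norm M).
  by rewrite -leNgt in h2; exact: le_trans (ler_norm M).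
apply/(integrable_mkcond _ mD); apply: measurable_bounded_integrable => //.
- apply: (@le_lt_trans _ _ (lebesgue_measure I * lebesgue_measure I)%E).
    by rewrite -product_measure1E.
  rewrite lebesgue_measure_itv /=.
  by case: ifP => _; rewrite ?mule0 // -?EFinD -EFinM ltry.
- by apply: measurable_funTS; exact: continuous_plane_measurable.
- exists K; split; first exact: num_real.
  by move=> x Kx p _ /=; exact: le_trans (hK p) (ltW Kx).
Qed.

Lemma is_derive_xP h p d :
  is_derive p ex h d <-> is_derive p.1 1 (fun t => h (t, p.2)) d.
Proof.
have E : (fun t : R => t^-1 *: (h (t *: ex + p) - h p)) =
  (fun t => t^-1 *: (h (t *: 1 + p.1, p.2) - h (p.1, p.2))).
  apply/funext => t; rewrite -surjective_pairing; congr (_ *: (h _ - _)).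
  rewrite (_ : t *: ex + p = (t *: 1 + p.1, t *: 0 + p.2)) //.
  by rewrite scaler0 add0r.
split=> -[]; rewrite /derivable /derive /= ?E => dh dE.
  by split; rewrite /derivable /derive.
by split; rewrite /derivable /derive /= E.
Qed.

Lemma is_derive_yP h p d :
  is_derive p ey h d <-> is_derive p.2 1 (fun t => h (p.1, t)) d.
Proof.
have E : (fun t : R => t^-1 *: (h (t *: ey + p) - h p)) =
  (fun t => t^-1 *: (h (p.1, t *: 1 + p.2) - h (p.1, p.2))).
  apply/funext => t; rewrite -surjective_pairing; congr (_ *: (h _ - _)).
  rewrite (_ : t *: ey + p = (t *: 0 + p.1, t *: 1 + p.2)) //.
  by rewrite scaler0 add0r.
split=> -[]; rewrite /derivable /derive /= ?E => dh dE.
  by split; rewrite /derivable /derive.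
by split; rewrite /derivable /derive /= E.
Qed.

Lemma integral_derive_bump (F f : R -> R) (M : R) :
  (forall x : R, is_derive x 1 F (f x)) -> continuous f ->
  (forall x : R, M < `|x| -> F x = 0) -> (forall x : R, M < `|x| -> f x = 0) ->
  (\int[lebesgue_measure]_x (f x)%:E = 0)%E.
Proof.
move=> dF cf F0 f0; pose N := `|M| + 1.
have N0 : 0 < N by rewrite ltr_wpDl.
have MN : M < N by rewrite (le_lt_trans (ler_norm _)) // ltrDl.
rewrite (_ : (fun x => (f x)%:E) = (EFin \o f) \_ `[- N, N]); last first.
  apply/funext => x; rewrite /patch; case: ifPn => // /negP xN.
  rewrite f0 //; rewrite ltNge; apply/negP => xM; apply: xN.
  by rewrite inE /= in_itv /= -ler_norml (le_trans xM) // ltW.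
rewrite -integral_mkcond (@continuous_FTC2 _ f F) ?gtrN //.
- by rewrite !F0 ?normrN ?gtr0_norm // subee.
- exact: continuous_subspaceT.
- have cF : continuous F.
    by move=> x; apply: differentiable_continuous; apply/derivable1_diffP.
  split.
  + by move=> x _; exact: ex_derive.
  + exact/cvg_at_right_filter/cF.
  + exact/cvg_at_left_filter/cF.
- by move=> x _; rewrite derive1E derive_val.
Qed.

(** By Fubini, integrate along the lines parallel to the axis of [x] first. *)
Lemma integral_partial_x0 h g M : (forall p, is_derive p ex h (g p)) ->
  continuous g -> boxed M h -> boxed M g -> \int[area]_p g p = 0.
Proof.
move=> dh cg bh bg; rewrite /Rintegral.
rewrite -(integral21_prod_meas1 (boxed_integrable cg bg)).
rewrite integral0_eq // => y _; rewrite /fubini_G /=.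
apply: (@integral_derive_bump (fun x => h (x, y)) (fun x => g (x, y)) M).
- by move=> x; exact: ((is_derive_xP _ _ _).1 (dh (x, y))).
- move=> x; apply: (@continuous_comp _ _ _ (fun x => (x, y)) g); last exact: cg.
  by apply: (@cvg_pair _ _ _ _ (nbhs _) (nbhs _)); [exact: cvg_id|exact: cvg_cst].
- by move=> x Mx; apply: bh; left.
- by move=> x Mx; apply: bg; left.
Qed.

Lemma integral_partial_y0 h g M : (forall p, is_derive p ey h (g p)) ->
  continuous g -> boxed M h -> boxed M g -> \int[area]_p g p = 0.
Proof.
move=> dh cg bh bg; rewrite /Rintegral.
rewrite -(integral12_prod_meas1 (boxed_integrable cg bg)).
rewrite integral0_eq // => x _; rewrite /fubini_F /=.
apply: (@integral_derive_bump (fun y => h (x, y)) (fun y => g (x, y)) M).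
- by move=> y; exact: ((is_derive_yP _ _ _).1 (dh (x, y))).
- move=> y; apply: (@continuous_comp _ _ _ (fun y => (x, y)) g); last exact: cg.
  by apply: (@cvg_pair _ _ _ _ (nbhs _) (nbhs _)); [exact: cvg_cst|exact: cvg_id].
- by move=> y My; apply: bh; right.
- by move=> y My; apply: bg; right.
Qed.

End plane_calculus.

(** * Smooth functions on the plane *)

Section smooth_functions.
Variable R : realType.
Implicit Types (h g : R * R -> R) (p : R * R).

Local Notation ex := ((1, 0) : R * R).
Local Notation ey := ((0, 1) : R * R).

Definition smooth h := forall n, Cn n h.

Lemma smooth_continuous h : smooth h -> continuous h.
Proof. by move=> /(_ 0%N)[]. Qed.

Lemma smooth_is_derive_x h p : smooth h -> is_derive p ex h (partial_x h p).
Proof. by move=> /(_ 1%N)[_ [dx _ _ _]]; exact/derivableP. Qed.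

Lemma smooth_is_derive_y h p : smooth h -> is_derive p ey h (partial_y h p).
Proof. by move=> /(_ 1%N)[_ [_ dy _ _]]; exact/derivableP. Qed.

Lemma smooth_partial_x h : smooth h -> smooth (partial_x h).
Proof. by move=> sh n; have [_ [_ _]] := sh n.+1. Qed.

Lemma smooth_partial_y h : smooth h -> smooth (partial_y h).
Proof. by move=> sh n; have [_ [_ _]] := sh n.+1. Qed.

Lemma partialE_x h (g : R * R -> R) :
  (forall p, is_derive p ex h (g p)) -> partial_x h = g.
Proof. by move=> d; apply/funext => p; rewrite /partial_x; apply: derive_val. Qed.

Lemma partialE_y h (g : R * R -> R) :
  (forall p, is_derive p ey h (g p)) -> partial_y h = g.
Proof. by move=> d; apply/funext => p; rewrite /partial_y; apply: derive_val. Qed.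

Lemma CnW n h : Cn n.+1 h -> Cn n h.
Proof.
elim: n h => [|n IH] h [ch [dx dy cx cy]]; first exact: (conj ch I).
exact: (conj ch (And4 dx dy (IH _ cx) (IH _ cy))).
Qed.

Lemma Cn_cst n (c : R) : Cn n (fun _ : R * R => c).
Proof.
elim: n c => [|n IH] c; (split; first by move=> p; exact: cvg_cst) => //.
split.
- by move=> p; exact: derivable_cst.
- by move=> p; exact: derivable_cst.
- rewrite (@partialE_x _ _ (fun p => is_derive_cst c p ex)); exact: IH.
- rewrite (@partialE_y _ _ (fun p => is_derive_cst c p ey)); exact: IH.
Qed.

Lemma CnD n h g : Cn n h -> Cn n g -> Cn n (fun p => h p + g p).
Proof.
elim: n h g => [|n IH] h g [ch Hh] [cg Hg];
  (split; first by move=> p; apply: cvgD; [exact: ch|exact: cg]) => //.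
case: Hh => hx hy hxn hyn; case: Hg => gx gy gxn gyn; split.
- by move=> p; exact: derivableD.
- by move=> p; exact: derivableD.
- rewrite (partialE_x (fun p => is_deriveD (derivableP (hx p)) (derivableP (gx p)))).
  exact: IH.
- rewrite (partialE_y (fun p => is_deriveD (derivableP (hy p)) (derivableP (gy p)))).
  exact: IH.
Qed.

Lemma CnM n h g : Cn n h -> Cn n g -> Cn n (fun p => h p * g p).
Proof.
elim: n h g => [|n IH] h g Ch Cg; move: (Ch) (Cg) => [ch Hh] [cg Hg];
  (split; first by move=> p; apply: cvgM; [exact: ch|exact: cg]) => //.
case: Hh => hx hy hxn hyn; case: Hg => gx gy gxn gyn; split.
- by move=> p; exact: derivableM.
- by move=> p; exact: derivableM.
- rewrite (partialE_x (fun p => is_deriveM (derivableP (hx p)) (derivableP (gx p)))).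
  by apply: CnD; apply: IH => //; exact: CnW.
- rewrite (partialE_y (fun p => is_deriveM (derivableP (hy p)) (derivableP (gy p)))).
  by apply: CnD; apply: IH => //; exact: CnW.
Qed.

Lemma is_derive_fst p (v : R * R) : is_derive p v (fst : R * R -> R) v.1.
Proof.
have E : (fun t : R => t^-1 *: ((fst \o shift p) (t *: v) - p.1)) @ 0^' --> v.1.
  apply: cvg_near_cst; near=> t => /=.
  have t0 : t != 0 by near: t; exact: nbhs_dnbhs_neq.
  by rewrite addrK /GRing.scale /= mulrA mulVf // mul1r.
by split; [apply/cvg_ex; exists v.1|exact/cvg_lim].
Unshelve. all: by end_near. Qed.

Lemma is_derive_snd p (v : R * R) : is_derive p v (snd : R * R -> R) v.2.
Proof.
have E : (fun t : R => t^-1 *: ((snd \o shift p) (t *: v) - p.2)) @ 0^' --> v.2.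
  apply: cvg_near_cst; near=> t => /=.
  have t0 : t != 0 by near: t; exact: nbhs_dnbhs_neq.
  by rewrite addrK /GRing.scale /= mulrA mulVf // mul1r.
by split; [apply/cvg_ex; exists v.2|exact/cvg_lim].
Unshelve. all: by end_near. Qed.

Lemma smooth_cst (c : R) : smooth (fun=> c).
Proof. by move=> n; exact: Cn_cst. Qed.

Lemma smoothD h g : smooth h -> smooth g -> smooth (fun p => h p + g p).
Proof. by move=> sh sg n; exact: CnD. Qed.

Lemma smoothM h g : smooth h -> smooth g -> smooth (fun p => h p * g p).
Proof. by move=> sh sg n; exact: CnM. Qed.

Lemma smooth_fst : smooth (fst : R * R -> R).
Proof.
case=> [|n]; (split; first by move=> p; exact: cvg_fst) => //; split.
- by move=> p; have [] := is_derive_fst p ex.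
- by move=> p; have [] := is_derive_fst p ey.
- rewrite (partialE_x (is_derive_fst^~ ex)); exact: Cn_cst.
- rewrite (partialE_y (is_derive_fst^~ ey)); exact: Cn_cst.
Qed.

Lemma smooth_snd : smooth (snd : R * R -> R).
Proof.
case=> [|n]; (split; first by move=> p; exact: cvg_snd) => //; split.
- by move=> p; have [] := is_derive_snd p ex.
- by move=> p; have [] := is_derive_snd p ey.
- rewrite (partialE_x (is_derive_snd^~ ex)); exact: Cn_cst.
- rewrite (partialE_y (is_derive_snd^~ ey)); exact: Cn_cst.
Qed.

Lemma is_derive_continuous (f df : R -> R) :
  (forall x : R, is_derive x 1 f (df x)) -> continuous f.
Proof.
by move=> d x; apply: differentiable_continuous; apply/derivable1_diffP.
Qed.

(** The mean value theorem, applied in each variable in turn. *)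
Lemma mixed_difference (f f1 f12 : R -> R -> R) (a b s : R) : 0 < s ->
  (forall x y : R, is_derive x 1 (f ^~ y) (f1 x y)) ->
  (forall x y : R, is_derive y 1 (f1 x) (f12 x y)) ->
  exists x y, [/\ a <= x <= a + s, b <= y <= b + s &
    f (a + s) (b + s) - f (a + s) b - (f a (b + s) - f a b) = f12 x y * s * s].
Proof.
move=> s0 d1 d12.
have dg (x : R) : is_derive x 1 (fun x => f x (b + s) - f x b) (f1 x (b + s) - f1 x b).
  exact: is_deriveB.
have [||x xab ->] := @MVT_segment _ _ _ a (a + s) _ (fun x _ => dg x).
- by rewrite lerDl ltW.
- exact/continuous_subspaceT/(is_derive_continuous dg).
have [||y yb ->] := @MVT_segment _ _ _ b (b + s) _ (fun y _ => d12 x y).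
- by rewrite lerDl ltW.
- exact/continuous_subspaceT/(is_derive_continuous (d12 x)).
exists x, y; split.
- by move: xab; rewrite in_itv.
- by move: yb; rewrite in_itv.
- by rewrite !(addrC _ s) !addrK.
Qed.

(** The second difference of [h] over a square does not depend on the order of the
    variables.  So, by [mixed_difference], the two mixed derivatives take a common
    value, possibly at distinct points, in every square with corner [p]; by
    continuity they agree at [p]. *)
Lemma partial_comm h : smooth h ->
  partial_x (partial_y h) = partial_y (partial_x h).
Proof.
move=> sh; apply/funext => p; apply/eqP; rewrite -subr_eq0 -normr_le0.
have itv (b t r s : R) : b <= t -> t <= b + s -> s < r -> b <= t < b + r.
  by move=> -> ts sr; rewrite (le_lt_trans ts) // ltrD2l.
apply/ler_addgt0Pl => e e0; rewrite addr0.
have e2 : 0 < e / 2 by rewrite divr_gt0.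
have near_c (g : R * R -> R) : continuous g -> exists2 r : R, 0 < r &
    forall x y, p.1 <= x < p.1 + r -> p.2 <= y < p.2 + r ->
    `|g p - g (x, y)| < e / 2.
  move=> /(_ p)/cvgrPdist_lt/(_ _ e2)/nbhs_ballP[r /= r0 hr]; exists r => //.
  move=> x y /andP[x1 x2] /andP[y1 y2]; apply: hr; split => /=;
    by rewrite /ball /= ler0_norm ?subr_le0 // opprB ltrBlDl.
have [r1 r10 h1] := near_c _ (smooth_continuous (smooth_partial_x (smooth_partial_y sh))).
have [r2 r20 h2] := near_c _ (smooth_continuous (smooth_partial_y (smooth_partial_x sh))).
have m0 : 0 < Num.min r1 r2 by rewrite lt_min r10.
have [s s0 sm] : exists2 s : R, 0 < s & s < Num.min r1 r2.
  exists (Num.min r1 r2 / 2); first by rewrite divr_gt0.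
  by rewrite ltr_pdivrMr // mulr_natr mulr2n ltrDl.
have [s1 s2] : s < r1 /\ s < r2 by move: sm; rewrite lt_min => /andP[].
have [x [y [/andP[x1 x2] /andP[y1 y2] E1]]] := @mixed_difference
  (fun x y => h (x, y)) (fun x y => partial_x h (x, y))
  (fun x y => partial_y (partial_x h) (x, y)) p.1 p.2 s s0
  (fun x y => (is_derive_xP _ _ _).1 (smooth_is_derive_x (x, y) sh))
  (fun x y => (is_derive_yP _ _ _).1 (smooth_is_derive_y (x, y) (smooth_partial_x sh))).
have [y' [x' [/andP[y1' y2'] /andP[x1' x2'] E2]]] := @mixed_difference
  (fun y x => h (x, y)) (fun y x => partial_y h (x, y))
  (fun y x => partial_x (partial_y h) (x, y)) p.2 p.1 s s0
  (fun y x => (is_derive_yP _ _ _).1 (smooth_is_derive_y (x, y) sh))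
  (fun y x => (is_derive_xP _ _ _).1 (smooth_is_derive_x (x, y) (smooth_partial_y sh))).
have E : partial_x (partial_y h) (x', y') = partial_y (partial_x h) (x, y).
  have ss : s * s != 0 by rewrite mulf_neq0 ?gt_eqF.
  have aux (u v w z A B : R) : u - v - (w - z) = A * s * s ->
      u - w - (v - z) = B * s * s -> B = A.
    by move=> e1 e3; apply: (mulIf ss); rewrite /= !mulrA -e1 -e3; ring.
  exact: aux E1 E2.
have k1 := h1 _ _ (itv _ _ _ _ x1' x2' s1) (itv _ _ _ _ y1' y2' s1).
have k2 := h2 _ _ (itv _ _ _ _ x1 x2 s2) (itv _ _ _ _ y1 y2 s2).
have tri (u v w : R) : `|u - w| < e / 2 -> `|v - w| < e / 2 -> `|u - v| <= e.
  move=> uw vw; rewrite (splitr e); apply: le_trans (ltW (ltrD uw vw)).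
  by rewrite (distrC v); exact: ler_distD.
by rewrite E in k1; exact: tri k1 k2.
Qed.

Definition bump h := smooth h /\ exists M, boxed M h.

Lemma boxedW M M' h : M <= M' -> boxed M h -> boxed M' h.
Proof.
by move=> MM bh p Mp; apply: bh; case: Mp => Mp; [left|right]; exact: le_lt_trans Mp.
Qed.

Lemma bump_continuous h : bump h -> continuous h.
Proof. by move=> [/smooth_continuous]. Qed.

Lemma bumpD h g : bump h -> bump g -> bump (fun p => h p + g p).
Proof.
move=> [sh [M bh]] [sg [N bg]]; split; first exact: smoothD.
exists (Num.max M N) => p Mp.
rewrite (boxedW _ bh Mp) ?le_max ?lexx // (boxedW _ bg Mp) ?addr0 //.
by rewrite le_max lexx orbT.
Qed.

Lemma bumpM h g : smooth h -> bump g -> bump (fun p => h p * g p).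
Proof.
move=> sh [sg [M bg]]; split; first exact: smoothM.
by exists M => p Mp; rewrite bg // mulr0.
Qed.

Lemma bumpZ (c : R) g : bump g -> bump (fun p => c * g p).
Proof. exact/bumpM/smooth_cst. Qed.

Lemma bumpN g : bump g -> bump (fun p => - g p).
Proof. by move=> /(bumpZ (-1)); under eq_fun do rewrite mulN1r. Qed.

Lemma bump0 : bump (fun=> 0).
Proof. by split; [exact: smooth_cst|exists 0]. Qed.

Lemma boxed_near M h p : boxed M h -> M < `|p.1| \/ M < `|p.2| ->
  \near p, (fun=> 0 : R) p = h p.
Proof.
move=> bh [Mp|Mp].
- have : \forall q \near p, M < `|q.1|.
    have c : `|q.1| @[q --> p] --> `|p.1| by apply: cvg_norm; exact: cvg_fst.
    exact: (cvgr_gt _ c).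
  by apply: filterS => q Mq; rewrite bh //; left.
- have : \forall q \near p, M < `|q.2|.
    have c : `|q.2| @[q --> p] --> `|p.2| by apply: cvg_norm; exact: cvg_snd.
    exact: (cvgr_gt _ c).
  by apply: filterS => q Mq; rewrite bh //; right.
Qed.

Lemma bump_partial_x h : bump h -> bump (partial_x h).
Proof.
move=> [sh [M bh]]; split; first exact: smooth_partial_x.
exists M => p Mp; rewrite /partial_x -(near_eq_derive _ (boxed_near bh Mp)).
exact: derive_cst.
Qed.

Lemma bump_partial_y h : bump h -> bump (partial_y h).
Proof.
move=> [sh [M bh]]; split; first exact: smooth_partial_y.
exists M => p Mp; rewrite /partial_y -(near_eq_derive _ (boxed_near bh Mp)).
exact: derive_cst.
Qed.

End smooth_functions.

(** * Commutation estimates for ladder operators *)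

(** [A] and [C] are adjoint operators with [C A - A C = 1] on the subspace [P];
    [E] is the real part of the inner product.  All the estimates are consequences
    of these relations. *)
Section weyl.
Local Open Scope complex_scope.
Variables (R : realType) (V : lmodType R[i]) (P : V -> Prop).
Variables (A C : V -> V) (E : V -> V -> R).
Hypothesis PD : forall f g, P f -> P g -> P (f + g).
Hypothesis PZ : forall c f, P f -> P (c *: f).
Hypothesis PA : forall f, P f -> P (A f).
Hypothesis PC : forall f, P f -> P (C f).
Hypothesis CD : forall f g, P f -> P g -> C (f + g) = C f + C g.
Hypothesis CZ : forall c f, P f -> C (c *: f) = c *: C f.
Hypothesis ED : forall f g h, P f -> P g -> P h -> E (f + g) h = E f h + E g h.
Hypothesis EC : forall f g, E f g = E g f.
Hypothesis EZ : forall c f g, P f -> P g -> E (c *: f) g = E f (c^*%C *: g).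
Hypothesis E_ge0 : forall f, P f -> 0 <= E f f.
Hypothesis Eadj : forall f g, P f -> P g -> E (A f) g = E f (C g).
Hypothesis CA : forall f, P f -> C (A f) = A (C f) + f.

Local Notation N f := (E f f).

Let PiterA k f : P f -> P (iter k A f).
Proof. by move=> Pf; elim: k => //= k; exact: PA. Qed.

Let PiterC k f : P f -> P (iter k C f).
Proof. by move=> Pf; elim: k => //= k; exact: PC. Qed.

Let EDr f g h : P f -> P g -> P h -> E f (g + h) = E f g + E f h.
Proof. by move=> *; rewrite EC ED // !(EC _ f). Qed.

Let EMn n f g : P f -> P g -> E (n%:R *: f) g = n%:R * E f g.
Proof.
move=> Pf Pg; elim: n => [|n IH].
  by have := ED (PZ 0 Pf) (PZ 0 Pf) Pg; rewrite !scale0r addr0 mul0r; lra.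
rewrite -!natr1 scalerDl scale1r ED //; last exact: PZ.
by rewrite IH mulrDl mul1r.
Qed.

Let EMnr n f g : P f -> P g -> E f (n%:R *: g) = n%:R * E f g.
Proof. by move=> Pf Pg; rewrite EC EMn // EC. Qed.

Lemma normD f g : P f -> P g -> N (f + g) = N f + 2 * E f g + N g.
Proof. by move=> Pf Pg; rewrite ED ?EDr //; [rewrite (EC g f); ring|exact: PD]. Qed.

Lemma iterC_A j f : P f ->
  iter j.+1 C (A f) = A (iter j.+1 C f) + j.+1%:R *: iter j C f.
Proof.
move=> Pf; elim: j => [|j IH]; first by rewrite /= scale1r CA.
rewrite [LHS]iterS IH CD ?CZ ?CA; try exact: PiterC; last 2 first.
- exact/PA/PiterC.
- exact/PZ/PiterC.
by rewrite -[C _]/(iter j.+2 C f) -addrA -[j.+2%:R]nat1r scalerDl scale1r.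
Qed.

Lemma norm_creation f : P f -> N (A f) = N (C f) + N f.
Proof.
move=> Pf; rewrite Eadj ?CA ?EDr //; try by [exact: PA|exact/PA/PC].
by rewrite EC Eadj //; exact: PC.
Qed.

(** Expand [C^j A = A C^j + j C^(j-1)]; the cross term is
    [2 j |C^j f|^2], because [C] is adjoint to [A]. *)
Lemma norm_iterC_A j f : P f -> N (iter j C (A f)) =
  N (iter j.+1 C f) + (j.*2.+1)%:R * N (iter j C f) +
  (j ^ 2)%:R * N (iter j.-1 C f).
Proof.
case: j => [|j] Pf; first by rewrite norm_creation // mul0r addr0 mul1r.
have PCj i := PiterC i Pf.
rewrite iterC_A // normD; [|exact/PA/PCj|exact/PZ/PCj].
rewrite norm_creation // EMnr //; last exact: PA.
rewrite EMn ?EMnr //; last exact: PZ.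
rewrite Eadj // -iterS.
by rewrite -!muln2 natrX -!natr1 natrM -natr1; ring.
Qed.

(** The recurrence [norm_iterC_A] for the numbers [k! * k^_m], which are the values
    of [|C^m A^k f|^2] at a unit vector [f] with [C f = 0]. *)
Lemma falling_recurrence k m :
  (k.+1 * k.+1 ^_ m = k ^_ m.+1 + (m.*2.+1) * k ^_ m + m ^ 2 * k ^_ m.-1)%N.
Proof.
case: m => [|m]; first by rewrite !ffactn0 ffactn1; lia.
rewrite ffactSS !ffactnSr /=; case: (leqP m k) => [mk|km]; last first.
  by rewrite ffact_small // !(muln0, mul0n).
have -> : (k - m.+1 = (k - m).-1)%N by lia.
rewrite -{1 2}(subnKC mk); move: (k ^_ m) (k - m)%N => X d.
by rewrite -mulnn; case: d => [|d] /=; lia.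
Qed.

(** By induction on [k] through [norm_iterC_A], in which all coefficients are
    nonnegative.  The case [m = 0] is the one of interest; its induction step calls
    for the other values of [m]. *)
Lemma norm_iterC_iterA f k m : P f ->
  N (iter (m + k.+1) C f) + (k.+1`! * k.+1 ^_ m)%:R * N f <=
  N (iter m C (iter k.+1 A f)).
Proof.
move=> Pf; have N0 i : 0 <= N (iter i C f) by exact/E_ge0/PiterC.
elim: k m => [|k IH] m.
  rewrite [iter _ A f]/= norm_iterC_A // addn1 -addrA lerD2l mul1n.
  case: m => [|[|m]].
  - by rewrite ffactn0 mul0r addr0.
  - by rewrite ffactn1 lerDr mulr_ge0.
  - by rewrite ffact_small // mul0r addr_ge0 // mulr_ge0.
rewrite [iter k.+2 A f]iterS norm_iterC_A; last exact: PiterA.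
have -> : (k.+2`! * k.+2 ^_ m)%:R * N f =
    (k.+1`! * k.+1 ^_ m.+1)%:R * N f +
    (m.*2.+1)%:R * ((k.+1`! * k.+1 ^_ m)%:R * N f) +
    (m ^ 2)%:R * ((k.+1`! * k.+1 ^_ m.-1)%:R * N f).
  rewrite !mulrA -!natrM -!mulrDl -!natrD; congr (_%:R * _).
  rewrite [k.+2`!]factS (mulnC k.+2) -mulnA falling_recurrence.
  by rewrite !mulnDr !(mulnCA k.+1`!).
rewrite !addrA; apply: lerD; first apply: lerD.
- by have := IH m.+1; rewrite addSnnS.
- apply: ler_wpM2l => //; apply: le_trans (IH m).
  by rewrite lerDr.
- apply: ler_wpM2l => //; apply: le_trans (IH m.-1).
  by rewrite lerDr.
Qed.

Let E_iterA k f g : P f -> P g -> E (iter k A f) g = E f (iter k C g).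
Proof.
elim: k g => [//|k IH] g Pf Pg; rewrite iterS Eadj //; last exact: PiterA.
by rewrite IH -?iterSr //; exact: PC.
Qed.

Let C_iterZ k c f : P f -> iter k C (c *: f) = c *: iter k C f.
Proof.
by move=> Pf; elim: k => //= k ->; rewrite CZ //; exact: PiterC.
Qed.

(** Compare with [|C^k f + conj a f|^2 >= 0]: the cross terms of the two squares
    agree since [A^k] and [C^k] are adjoint. *)
Lemma weyl_coercive k a f : (0 < k)%N -> P f ->
  k`!%:R * N f <= N (iter k A f + a *: f).
Proof.
case: k => // k _ Pf; have PCk := PiterC k.+1 Pf; have PAk := PiterA k.+1 Pf.
have := norm_iterC_iterA k 0 Pf; rewrite add0n ffactn0 muln1 /= -iterS => h.
have := E_ge0 (PD PCk (PZ a^*%C Pf)).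
rewrite !normD //; try exact: PZ.
have -> : N (a^*%C *: f) = N (a *: f).
  rewrite !EZ //; try exact: PZ.
  by rewrite conjcK !scalerA mulrC.
have -> : E (iter k.+1 C f) (a^*%C *: f) = E (iter k.+1 A f) (a *: f).
  rewrite E_iterA //; last exact: PZ.
  by rewrite C_iterZ // EC EZ // conjcK.
by move: h; rewrite /= ; lra.
Qed.

End weyl.

(** * Ladder operators on test functions *)

Section fock_operators.
Local Open Scope complex_scope.
Variable R : realType.
Implicit Types (f g phi : R[i] -> R[i]) (h u v : R * R -> R) (p : R * R).

Local Notation area := ((@lebesgue_measure R) \x (@lebesgue_measure R))%E.
Local Notation plane := (measurableTypeR R * measurableTypeR R)%type.
Local Notation ex := ((1, 0) : R * R).
Local Notation ey := ((0, 1) : R * R).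

Lemma toCK : cancel (@toC R) (@ofC R). Proof. by case. Qed.
Lemma ofCK : cancel (@ofC R) (@toC R). Proof. by case. Qed.

Lemma cfun_eq f g : repart f = repart g -> impart f = impart g -> f = g.
Proof.
move=> rfg ifg; apply/funext => z; rewrite -(ofCK z).
have := congr1 (@^~ (ofC z)) rfg; have := congr1 (@^~ (ofC z)) ifg.
rewrite /repart /impart; case: (f _) => a b; case: (g _) => c d /= -> ->.
by [].
Qed.

Lemma ReM (x y : R[i]) : complex.Re (x * y) =
  complex.Re x * complex.Re y - complex.Im x * complex.Im y.
Proof. by case: x; case: y. Qed.

Lemma ImM (x y : R[i]) : complex.Im (x * y) =
  complex.Re x * complex.Im y + complex.Im x * complex.Re y.
Proof. by case: x; case: y. Qed.

Lemma ReD (x y : R[i]) : complex.Re (x + y) = complex.Re x + complex.Re y.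
Proof. by case: x; case: y. Qed.

Lemma ImD (x y : R[i]) : complex.Im (x + y) = complex.Im x + complex.Im y.
Proof. by case: x; case: y. Qed.

Lemma ReN (x : R[i]) : complex.Re (- x) = - complex.Re x.
Proof. by case: x. Qed.

Lemma ImN (x : R[i]) : complex.Im (- x) = - complex.Im x.
Proof. by case: x. Qed.

Let ReImE := (ReM, ImM, ReD, ImD, ReN, ImN).

Lemma repartD f g : repart (f + g) = fun p => repart f p + repart g p.
Proof. by apply/funext => p; exact: ReD. Qed.

Lemma impartD f g : impart (f + g) = fun p => impart f p + impart g p.
Proof. by apply/funext => p; exact: ImD. Qed.

Lemma repartZ (c : R[i]) f : repart (c *: f) =
  fun p => complex.Re c * repart f p + - complex.Im c * impart f p.
Proof. by apply/funext => p; rewrite mulNr; exact: ReM. Qed.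

Lemma impartZ (c : R[i]) f : impart (c *: f) =
  fun p => complex.Re c * impart f p + complex.Im c * repart f p.
Proof. by apply/funext => p; exact: ImM. Qed.

Definition ctest f := bump (repart f) /\ bump (impart f).

Lemma ctestD f g : ctest f -> ctest g -> ctest (f + g).
Proof.
by move=> [? ?] [? ?]; split; rewrite ?repartD ?impartD; exact: bumpD.
Qed.

Lemma ctestZ c f : ctest f -> ctest (c *: f).
Proof.
by move=> [? ?]; split; rewrite ?repartZ ?impartZ; apply: bumpD; exact: bumpZ.
Qed.

Definition creation f := - dbar f.
(** The operator [d/dz + conj z], adjoint to [creation] for the weight
    [exp (|z|^2)]. *)
Definition annihilation f : R[i] -> R[i] := fun z =>
  2^-1 * (cpartial_x f z - 'i%C * cpartial_y f z) + z^*%C * f z.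

Let half : (2^-1 : R[i]) = (2^-1 : R)%:C.
Proof. by rewrite -[2 in LHS](rmorph_nat (real_complex R)) -fmorphV. Qed.

Lemma repart_creation f : repart (creation f) = fun p =>
  - 2^-1 * partial_x (repart f) p + 2^-1 * partial_y (impart f) p.
Proof.
apply/funext => p; rewrite [LHS]ReN /dbar half !ReImE /= toCK /=; ring.
Qed.

Lemma impart_creation f : impart (creation f) = fun p =>
  - 2^-1 * partial_x (impart f) p + - 2^-1 * partial_y (repart f) p.
Proof.
apply/funext => p; rewrite [LHS]ImN /dbar half !ReImE /= toCK /=; ring.
Qed.

Lemma repart_annihilation f : repart (annihilation f) = fun p =>
  2^-1 * partial_x (repart f) p + 2^-1 * partial_y (impart f) p +
  (p.1 * repart f p + p.2 * impart f p).
Proof.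
apply/funext => p; rewrite {1}/repart /annihilation half !ReImE /= toCK /=.
by rewrite -/(repart f p) -/(impart f p); ring.
Qed.

Lemma impart_annihilation f : impart (annihilation f) = fun p =>
  2^-1 * partial_x (impart f) p + - 2^-1 * partial_y (repart f) p +
  (p.1 * impart f p + - (p.2 * repart f p)).
Proof.
apply/funext => p; rewrite {1}/impart /annihilation half !ReImE /= toCK /=.
by rewrite -/(repart f p) -/(impart f p); ring.
Qed.

Lemma ctest_creation f : ctest f -> ctest (creation f).
Proof.
move=> [rf jf]; split.
  rewrite repart_creation.
  exact: bumpD (bumpZ _ (bump_partial_x rf)) (bumpZ _ (bump_partial_y jf)).
rewrite impart_creation.
exact: bumpD (bumpZ _ (bump_partial_x jf)) (bumpZ _ (bump_partial_y rf)).
Qed.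

Lemma ctest_annihilation f : ctest f -> ctest (annihilation f).
Proof.
move=> [rf jf]; split.
  rewrite repart_annihilation; apply: bumpD.
    exact: bumpD (bumpZ _ (bump_partial_x rf)) (bumpZ _ (bump_partial_y jf)).
  exact: bumpD (bumpM (@smooth_fst R) rf) (bumpM (@smooth_snd R) jf).
rewrite impart_annihilation; apply: bumpD.
  exact: bumpD (bumpZ _ (bump_partial_x jf)) (bumpZ _ (bump_partial_y rf)).
exact: bumpD (bumpM (@smooth_fst R) jf) (bumpN (bumpM (@smooth_snd R) rf)).
Qed.

Lemma test_function_ctest phi : test_function phi -> ctest phi.
Proof.
move=> [sm cS].
have [B [_ /(_ (B + 1))]] := compact_bounded cS.
rewrite ltrDl ltr01 => /(_ isT) hB.
have z p : B + 1 < `|p.1| \/ B + 1 < `|p.2| -> phi (toC p) = 0.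
  move=> Bp; apply/eqP; apply: contraT => np.
  have : `|p| <= B + 1 := hB p (@subset_closure _ _ p np).
  rewrite prod_normE ge_max => /andP[p1 p2].
  by case: Bp; rewrite ltNge ?p1 ?p2.
by split; (split; [move=> n; have [] := sm n|exists (B + 1) => p /z pz]) => //;
  rewrite /repart /impart pz.
Qed.

(** The inverse of the Gaussian weight: the norm of [dual_of phi] in the Gaussian
    space is the norm of [phi] for this weight. *)
Definition weight p : R := expR (p.1 ^+ 2 + p.2 ^+ 2).

Lemma weight_gt0 p : 0 < weight p. Proof. exact: expR_gt0. Qed.

Let is_derive_gauss (c x : R) :
  is_derive x 1 (fun t => expR (t ^+ 2 + c)) (2 * x * expR (x ^+ 2 + c)).
Proof.
have dq : is_derive x 1 (fun t : R => t ^+ 2 + c) (2 * x).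
  by apply: is_derive_eq; rewrite addr0 /GRing.scale /= mulr1 /=; ring.
by rewrite mulrC; exact: (is_derive1_comp (is_derive_expR _) dq).
Qed.

Lemma is_derive_weight_x p : is_derive p ex weight (2 * p.1 * weight p).
Proof. exact: (is_derive_xP _ _ _).2 (is_derive_gauss (p.2 ^+ 2) p.1). Qed.

Lemma is_derive_weight_y p : is_derive p ey weight (2 * p.2 * weight p).
Proof.
have := is_derive_gauss (p.1 ^+ 2) p.2; rewrite addrC => d.
apply: (is_derive_yP _ _ _).2; move: d; congr (is_derive _ _ _ _).
by apply/funext => t; rewrite addrC.
Qed.

Lemma continuous_weight : continuous weight.
Proof.
move=> p; apply: (@continuous_comp _ _ _ (fun q : R * R => q.1 ^+ 2 + q.2 ^+ 2) expR).
  have s1 := smoothM (@smooth_fst R) (@smooth_fst R).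
  have s2 := smoothM (@smooth_snd R) (@smooth_snd R).
  exact: (smooth_continuous (smoothD s1 s2)).
exact: continuous_expR.
Qed.

Lemma bump_weight_integrable h : bump h ->
  area.-integrable [set: plane] (EFin \o (fun p => h p * weight p)).
Proof.
move=> [sh [M bh]]; apply: (@boxed_integrable _ M).
  by move=> p; apply: cvgM; [exact: smooth_continuous|exact: continuous_weight].
by move=> p Mp; rewrite bh // mul0r.
Qed.

Definition wint h : R := \int[area]_p (h p * weight p).

Lemma wintD h u : bump h -> bump u ->
  wint (fun p => h p + u p) = wint h + wint u.
Proof.
move=> bh bu; rewrite /wint -RintegralD //; try exact: bump_weight_integrable.
by apply: eq_Rintegral => p _; rewrite mulrDl.
Qed.

Lemma wintZ c h : bump h -> wint (fun p => c * h p) = c * wint h.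
Proof.
move=> bh; rewrite /wint -RintegralZl //; last exact: bump_weight_integrable.
by apply: eq_Rintegral => p _; rewrite mulrA.
Qed.

(** The integrand times the weight is the derivative of [u * weight]. *)
Lemma wint_partial_x u : bump u ->
  wint (fun p => partial_x u p + 2 * p.1 * u p) = 0.
Proof.
move=> bu; have [su [M bM]] := bu; have [_ [M' bM']] := bump_partial_x bu.
pose K := Num.max M M'.
have bK : boxed K u by apply: boxedW bM; rewrite le_max lexx.
have bK' : boxed K (partial_x u) by apply: boxedW bM'; rewrite le_max lexx orbT.
have s1 := bump_continuous (bumpD (bump_partial_x bu)
  (bumpM (smoothM (smooth_cst 2) (@smooth_fst R)) bu)).
apply: (@integral_partial_x0 _ (fun p => u p * weight p) _ K).
- move=> p; have := is_deriveM (smooth_is_derive_x p su) (is_derive_weight_x p).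
  by move=> d; apply: is_derive_eq; rewrite /GRing.scale /=; ring.
- by move=> p; apply: cvgM; [exact: s1|exact: continuous_weight].
- by move=> p Mp; rewrite bK // mul0r.
- by move=> p Mp; rewrite bK // bK' // mulr0 addr0 mul0r.
Qed.

Lemma wint_partial_y u : bump u ->
  wint (fun p => partial_y u p + 2 * p.2 * u p) = 0.
Proof.
move=> bu; have [su [M bM]] := bu; have [_ [M' bM']] := bump_partial_y bu.
pose K := Num.max M M'.
have bK : boxed K u by apply: boxedW bM; rewrite le_max lexx.
have bK' : boxed K (partial_y u) by apply: boxedW bM'; rewrite le_max lexx orbT.
have s1 := bump_continuous (bumpD (bump_partial_y bu)
  (bumpM (smoothM (smooth_cst 2) (@smooth_snd R)) bu)).
apply: (@integral_partial_y0 _ (fun p => u p * weight p) _ K).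
- move=> p; have := is_deriveM (smooth_is_derive_y p su) (is_derive_weight_y p).
  by move=> d; apply: is_derive_eq; rewrite /GRing.scale /=; ring.
- by move=> p; apply: cvgM; [exact: s1|exact: continuous_weight].
- by move=> p Mp; rewrite bK // mul0r.
- by move=> p Mp; rewrite bK // bK' // mulr0 addr0 mul0r.
Qed.

Definition energy f g : R :=
  wint (fun p => repart f p * repart g p + impart f p * impart g p).

End fock_operators.

Section energy_estimate.
Local Open Scope complex_scope.
Variable R : realType.
Implicit Types (f g phi : R[i] -> R[i]) (h u v : R * R -> R) (p : R * R).

Local Notation ex := ((1, 0) : R * R).
Local Notation ey := ((0, 1) : R * R).

Lemma partial_xD h u : smooth h -> smooth u ->
  partial_x (fun p => h p + u p) = fun p => partial_x h p + partial_x u p.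
Proof.
move=> sh su; apply: partialE_x => p.
exact: is_deriveD (smooth_is_derive_x p sh) (smooth_is_derive_x p su).
Qed.

Lemma partial_yD h u : smooth h -> smooth u ->
  partial_y (fun p => h p + u p) = fun p => partial_y h p + partial_y u p.
Proof.
move=> sh su; apply: partialE_y => p.
exact: is_deriveD (smooth_is_derive_y p sh) (smooth_is_derive_y p su).
Qed.

Lemma partial_xM h u : smooth h -> smooth u ->
  partial_x (fun p => h p * u p) =
  fun p => h p * partial_x u p + u p * partial_x h p.
Proof.
move=> sh su; apply: partialE_x => p.
exact: is_deriveM (smooth_is_derive_x p sh) (smooth_is_derive_x p su).
Qed.

Lemma partial_yM h u : smooth h -> smooth u ->
  partial_y (fun p => h p * u p) =
  fun p => h p * partial_y u p + u p * partial_y h p.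
Proof.
move=> sh su; apply: partialE_y => p.
exact: is_deriveM (smooth_is_derive_y p sh) (smooth_is_derive_y p su).
Qed.

Lemma partial_xZ (c : R) u : smooth u ->
  partial_x (fun p => c * u p) = fun p => c * partial_x u p.
Proof.
move=> su; apply: partialE_x => p.
exact: is_deriveZ (smooth_is_derive_x p su).
Qed.

Lemma partial_yZ (c : R) u : smooth u ->
  partial_y (fun p => c * u p) = fun p => c * partial_y u p.
Proof.
move=> su; apply: partialE_y => p.
exact: is_deriveZ (smooth_is_derive_y p su).
Qed.

Lemma partial_xN u : smooth u ->
  partial_x (fun p => - u p) = fun p => - partial_x u p.
Proof.
move=> su; apply: partialE_x => p.
exact: is_deriveN (smooth_is_derive_x p su).
Qed.

Lemma partial_yN u : smooth u ->
  partial_y (fun p => - u p) = fun p => - partial_y u p.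
Proof.
move=> su; apply: partialE_y => p.
exact: is_deriveN (smooth_is_derive_y p su).
Qed.

Lemma partial_x_fstM u : smooth u ->
  partial_x (fun p => p.1 * u p) = fun p => p.1 * partial_x u p + u p.
Proof.
move=> su; rewrite (partial_xM (@smooth_fst R) su).
by rewrite (partialE_x ((@is_derive_fst R)^~ ex)); apply/funext => p; rewrite mulr1.
Qed.

Lemma partial_y_fstM u : smooth u ->
  partial_y (fun p => p.1 * u p) = fun p => p.1 * partial_y u p.
Proof.
move=> su; rewrite (partial_yM (@smooth_fst R) su).
by rewrite (partialE_y ((@is_derive_fst R)^~ ey)); apply/funext => p; rewrite mulr0 addr0.
Qed.

Lemma partial_x_sndM u : smooth u ->
  partial_x (fun p => p.2 * u p) = fun p => p.2 * partial_x u p.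
Proof.
move=> su; rewrite (partial_xM (@smooth_snd R) su).
by rewrite (partialE_x ((@is_derive_snd R)^~ ex)); apply/funext => p; rewrite mulr0 addr0.
Qed.

Lemma partial_y_sndM u : smooth u ->
  partial_y (fun p => p.2 * u p) = fun p => p.2 * partial_y u p + u p.
Proof.
move=> su; rewrite (partial_yM (@smooth_snd R) su).
by rewrite (partialE_y ((@is_derive_snd R)^~ ey)); apply/funext => p; rewrite mulr1.
Qed.

Lemma creationD f g : ctest f -> ctest g ->
  creation (f + g) = creation f + creation g.
Proof.
move=> [[sf1 _] [sf2 _]] [[sg1 _] [sg2 _]]; apply: cfun_eq.
  rewrite (repartD (creation _)) !repart_creation repartD impartD.
  rewrite (partial_xD sf1 sg1) (partial_yD sf2 sg2); apply/funext => p.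
  by move: (partial_x _ p) (partial_x _ p) (partial_y _ p) (partial_y _ p); intros; ring.
rewrite (impartD (creation _)) !impart_creation repartD impartD.
rewrite (partial_xD sf2 sg2) (partial_yD sf1 sg1); apply/funext => p.
by move: (partial_x _ p) (partial_x _ p) (partial_y _ p) (partial_y _ p); intros; ring.
Qed.

Lemma creationZ c f : ctest f -> creation (c *: f) = c *: creation f.
Proof.
move=> [[s1 _] [s2 _]].
have z1 a := smoothM (smooth_cst a) s1; have z2 a := smoothM (smooth_cst a) s2.
apply: cfun_eq.
  rewrite repartZ !repart_creation impart_creation repartZ impartZ.
  rewrite (partial_xD (z1 _) (z2 _)) (partial_yD (z2 _) (z1 _)).
  rewrite !(partial_xZ _ s1) !(partial_xZ _ s2) !(partial_yZ _ s1) !(partial_yZ _ s2).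
  apply/funext => p.
  by move: (partial_x _ p) (partial_x _ p) (partial_y _ p) (partial_y _ p); intros; ring.
rewrite impartZ !impart_creation repart_creation repartZ impartZ.
rewrite (partial_xD (z2 _) (z1 _)) (partial_yD (z1 _) (z2 _)).
rewrite !(partial_xZ _ s1) !(partial_xZ _ s2) !(partial_yZ _ s1) !(partial_yZ _ s2).
apply/funext => p.
by move: (partial_x _ p) (partial_x _ p) (partial_y _ p) (partial_y _ p); intros; ring.
Qed.

Lemma annihilationD f g : ctest f -> ctest g ->
  annihilation (f + g) = annihilation f + annihilation g.
Proof.
move=> [[sf1 _] [sf2 _]] [[sg1 _] [sg2 _]]; apply: cfun_eq.
  rewrite (repartD (annihilation _)) !repart_annihilation repartD impartD.
  rewrite (partial_xD sf1 sg1) (partial_yD sf2 sg2); apply/funext => p.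
  by move: (partial_x _ p) (partial_x _ p) (partial_y _ p) (partial_y _ p); intros; ring.
rewrite (impartD (annihilation _)) !impart_annihilation repartD impartD.
rewrite (partial_xD sf2 sg2) (partial_yD sf1 sg1); apply/funext => p.
by move: (partial_x _ p) (partial_x _ p) (partial_y _ p) (partial_y _ p); intros; ring.
Qed.

Lemma annihilationZ c f : ctest f -> annihilation (c *: f) = c *: annihilation f.
Proof.
move=> [[s1 _] [s2 _]].
have z1 a := smoothM (smooth_cst a) s1; have z2 a := smoothM (smooth_cst a) s2.
apply: cfun_eq.
  rewrite repartZ !repart_annihilation impart_annihilation repartZ impartZ.
  rewrite (partial_xD (z1 _) (z2 _)) (partial_yD (z2 _) (z1 _)).
  rewrite !(partial_xZ _ s1) !(partial_xZ _ s2) !(partial_yZ _ s1) !(partial_yZ _ s2).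
  apply/funext => p.
  by move: (partial_x _ p) (partial_x _ p) (partial_y _ p) (partial_y _ p); intros; ring.
rewrite impartZ !impart_annihilation repart_annihilation repartZ impartZ.
rewrite (partial_xD (z2 _) (z1 _)) (partial_yD (z1 _) (z2 _)).
rewrite !(partial_xZ _ s1) !(partial_xZ _ s2) !(partial_yZ _ s1) !(partial_yZ _ s2).
apply/funext => p.
by move: (partial_x _ p) (partial_x _ p) (partial_y _ p) (partial_y _ p); intros; ring.
Qed.

(** The second derivatives cancel by [partial_comm], and the term [f] arises from
    [d/dzbar (conj z * f)]. *)
Lemma commutator f : ctest f ->
  annihilation (creation f) = creation (annihilation f) + f.
Proof.
move=> [[s1 _] [s2 _]].
have s1x := smooth_partial_x s1; have s1y := smooth_partial_y s1.
have s2x := smooth_partial_x s2; have s2y := smooth_partial_y s2.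
have Z a u (su : smooth u) := smoothM (smooth_cst a) su.
have X u (su : smooth u) := smoothM (@smooth_fst R) su.
have Y u (su : smooth u) := smoothM (@smooth_snd R) su.
have sN u (su : smooth u) : smooth (fun p => - u p).
  by move: (Z (-1) u su); under eq_fun do rewrite mulN1r.
have sYN := sN _ (Y _ s1).
apply: cfun_eq.
  rewrite (repartD (creation _)) repart_annihilation !repart_creation impart_creation.
  rewrite repart_annihilation impart_annihilation.
  rewrite (partial_xD (Z _ _ s1x) (Z _ _ s2y)) (partial_yD (Z _ _ s2x) (Z _ _ s1y)).
  rewrite (partial_xD (smoothD (Z _ _ s1x) (Z _ _ s2y)) (smoothD (X _ s1) (Y _ s2))).
  rewrite (partial_yD (smoothD (Z _ _ s2x) (Z _ _ s1y)) (smoothD (X _ s2) sYN)).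
  rewrite (partial_xD (Z _ _ s1x) (Z _ _ s2y)) (partial_yD (Z _ _ s2x) (Z _ _ s1y)).
  rewrite (partial_xD (X _ s1) (Y _ s2)) (partial_yD (X _ s2) sYN).
  rewrite !(partial_xZ _ s1x) !(partial_xZ _ s2y) !(partial_yZ _ s2x) !(partial_yZ _ s1y).
  rewrite (partial_x_fstM s1) (partial_x_sndM s2) (partial_y_fstM s2).
  rewrite (partial_yN (Y _ s1)) (partial_y_sndM s1) (partial_comm s2).
  apply/funext => p.
  move: (partial_x (partial_x (repart f)) p) (partial_y (partial_x (impart f)) p)
    (partial_y (partial_y (repart f)) p).
  move: (partial_x (repart f) p) (partial_y (repart f) p)
    (partial_x (impart f) p) (partial_y (impart f) p); intros.
  by field.
rewrite (impartD (creation _)) impart_annihilation !impart_creation repart_creation.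
rewrite repart_annihilation impart_annihilation.
rewrite (partial_yD (Z _ _ s1x) (Z _ _ s2y)) (partial_xD (Z _ _ s2x) (Z _ _ s1y)).
rewrite (partial_yD (smoothD (Z _ _ s1x) (Z _ _ s2y)) (smoothD (X _ s1) (Y _ s2))).
rewrite (partial_xD (smoothD (Z _ _ s2x) (Z _ _ s1y)) (smoothD (X _ s2) sYN)).
rewrite (partial_yD (Z _ _ s1x) (Z _ _ s2y)) (partial_xD (Z _ _ s2x) (Z _ _ s1y)).
rewrite (partial_yD (X _ s1) (Y _ s2)) (partial_xD (X _ s2) sYN).
rewrite !(partial_yZ _ s1x) !(partial_yZ _ s2y) !(partial_xZ _ s2x) !(partial_xZ _ s1y).
rewrite (partial_y_fstM s1) (partial_y_sndM s2) (partial_x_fstM s2).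
rewrite (partial_xN (Y _ s1)) (partial_x_sndM s1) (partial_comm s1).
apply/funext => p.
move: (partial_x (partial_x (impart f)) p) (partial_y (partial_x (repart f)) p)
  (partial_y (partial_y (impart f)) p).
move: (partial_x (repart f) p) (partial_y (repart f) p)
  (partial_x (impart f) p) (partial_y (impart f) p); intros.
by field.
Qed.

Let bump_dot f g : ctest f -> ctest g ->
  bump (fun p => repart f p * repart g p + impart f p * impart g p).
Proof.
move=> [[s1 _] [s2 _]] [b1 b2].
exact: bumpD (bumpM s1 b1) (bumpM s2 b2).
Qed.

Lemma energyD f g phi : ctest f -> ctest g -> ctest phi ->
  energy (f + g) phi = energy f phi + energy g phi.
Proof.
move=> tf tg tp; rewrite /energy -(wintD (bump_dot tf tp) (bump_dot tg tp)).
by congr wint; apply/funext => p; rewrite repartD impartD; ring.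
Qed.

Lemma energyC f g : energy f g = energy g f.
Proof.
by congr wint; apply/funext => p; rewrite mulrC (mulrC (impart f p)).
Qed.

Lemma energyZ c f g : energy (c *: f) g = energy f (c^*%C *: g).
Proof.
congr wint; apply/funext => p; rewrite !repartZ !impartZ.
by case: c => a b /=; ring.
Qed.

Lemma energy_ge0 f : 0 <= energy f f.
Proof.
apply: Rintegral_ge0 => p _; apply: mulr_ge0; last exact: ltW (weight_gt0 p).
by rewrite addr_ge0 // -expr2 sqr_ge0.
Qed.

(** The difference of the two integrands is
    [- 1/2 * (d/dx (u * weight) + d/dy (v * weight))] with [u] and [v] the real and
    imaginary parts of [conj f * g]. *)
Lemma energy_adjoint f g : ctest f -> ctest g ->
  energy (creation f) g = energy f (annihilation g).
Proof.
move=> tf tg; have [b1 b2] := tf; have [c1 c2] := tg.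
have [s1 _] := b1; have [s2 _] := b2; have [r1 _] := c1; have [r2 _] := c2.
pose u p := repart f p * repart g p + impart f p * impart g p.
pose v p := repart f p * impart g p + (-1) * (impart f p * repart g p).
have bu : bump u by exact: bumpD (bumpM s1 c1) (bumpM s2 c2).
have bv : bump v by exact: bumpD (bumpM s1 c2) (bumpZ _ (bumpM s2 c1)).
have ux : partial_x u = fun p =>
    repart f p * partial_x (repart g) p + repart g p * partial_x (repart f) p +
    (impart f p * partial_x (impart g) p + impart g p * partial_x (impart f) p).
  by rewrite (partial_xD (smoothM s1 r1) (smoothM s2 r2)) (partial_xM s1 r1)
             (partial_xM s2 r2).
have vy : partial_y v = fun p =>
    repart f p * partial_y (impart g) p + impart g p * partial_y (repart f) p +
    (-1) * (impart f p * partial_y (repart g) p + repart g p * partial_y (impart f) p).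
  by rewrite (partial_yD (smoothM s1 r2) (smoothM (smooth_cst _) (smoothM s2 r1)))
             (partial_yM s1 r2) (partial_yZ _ (smoothM s2 r1)) (partial_yM s2 r1).
have bX : bump (fun p => partial_x u p + 2 * p.1 * u p).
  exact: bumpD (bump_partial_x bu) (bumpM (smoothM (smooth_cst 2) (@smooth_fst R)) bu).
have bY : bump (fun p => partial_y v p + 2 * p.2 * v p).
  exact: bumpD (bump_partial_y bv) (bumpM (smoothM (smooth_cst 2) (@smooth_snd R)) bv).
have bXY := bumpZ (- 2^-1) (bumpD bX bY).
have I0 : wint (fun p => - 2^-1 * (partial_x u p + 2 * p.1 * u p +
    (partial_y v p + 2 * p.2 * v p))) = 0.
  by rewrite (wintZ _ (bumpD bX bY)) (wintD bX bY) (wint_partial_x bu)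
             (wint_partial_y bv) addr0 mulr0.
rewrite -[RHS]add0r -I0 /energy.
rewrite -(wintD bXY (bump_dot tf (ctest_annihilation tg))).
congr wint; apply/funext => p.
rewrite repart_creation impart_creation repart_annihilation impart_annihilation.
rewrite ux vy /u /v.
move: (partial_x (repart f) p) (partial_y (repart f) p)
  (partial_x (impart f) p) (partial_y (impart f) p).
move: (partial_x (repart g) p) (partial_y (repart g) p)
  (partial_x (impart g) p) (partial_y (impart g) p); intros.
by field.
Qed.

Lemma energy_coercive k a phi : (0 < k)%N -> ctest phi ->
  k`!%:R * energy phi phi <=
  energy (iter k (@creation R) phi + a *: phi)
         (iter k (@creation R) phi + a *: phi).
Proof.
move=> k0 tp; apply: (@weyl_coercive R _ (@ctest R) _ (@annihilation R)
  (@energy R)) => //.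
- exact: ctestD.
- exact: ctestZ.
- exact: ctest_creation.
- exact: ctest_annihilation.
- exact: annihilationD.
- exact: annihilationZ.
- exact: energyD.
- exact: energyC.
- by move=> c f g _ _; exact: energyZ.
- by move=> f _; exact: energy_ge0.
- exact: energy_adjoint.
- exact: commutator.
Qed.
End energy_estimate.

(** * The weighted Hilbert space *)

Section weighted_L2.
Local Open Scope complex_scope.
Variable R : realType.
Implicit Types (f g : R[i] -> R[i]) (p : R * R).

Local Notation area := ((@lebesgue_measure R) \x (@lebesgue_measure R))%E.
Local Notation plane := (measurableTypeR R * measurableTypeR R)%type.
Local Open Scope quotient_scope.

Definition gauss p : R := expR (- Normc.normc (toC p) ^+ 2).

Lemma gauss_ge0 p : 0 <= gauss p. Proof. exact: expR_ge0. Qed.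

Lemma normc2E f p :
  Normc.normc (f (toC p)) ^+ 2 = repart f p ^+ 2 + impart f p ^+ 2.
Proof.
by rewrite /repart /impart; case: (f _) => a b; rewrite sqr_sqrtr ?addr_ge0 ?sqr_ge0.
Qed.

Lemma gaussE p : gauss p = (weight p)^-1.
Proof. by rewrite /gauss (normc2E id) expRN. Qed.

Definition pairing f g p : R :=
  (repart f p * repart g p + impart f p * impart g p) * gauss p.

Definition dot f g : R := \int[area]_p pairing f g p.

Lemma measurable_pairing f g : cmeasurable f -> cmeasurable g ->
  measurable_fun [set: plane] (pairing f g).
Proof.
move=> [rf jf] [rg jg]; apply: measurable_funM; last exact: measurable_weight.
by apply: measurable_funD; apply: measurable_funM.
Qed.

Lemma pairing_sqr f p : pairing f f p = Normc.normc (f (toC p)) ^+ 2 * gauss p.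
Proof. by rewrite normc2E /pairing -!expr2. Qed.

Lemma pairing_ge0 f p : 0 <= pairing f f p.
Proof. by rewrite pairing_sqr mulr_ge0 ?sqr_ge0 ?gauss_ge0. Qed.

Lemma wsqnormE f : wsqnorm f = (\int[area]_p (pairing f f p)%:E)%E.
Proof. by apply: eq_integral => p _; rewrite pairing_sqr. Qed.

Lemma L2w_integrable_sqr f : f \in @L2w R ->
  area.-integrable [set: plane] (fun p => (pairing f f p)%:E).
Proof.
rewrite inE => -[[mf _] ff]; apply/integrableP; split.
  by apply/measurable_EFinP; exact: measurable_pairing.
under eq_integral do rewrite gee0_abs ?lee_fin ?pairing_ge0 //.
by rewrite -wsqnormE.
Qed.

Lemma L2w_integrable f g : f \in @L2w R -> g \in @L2w R ->
  area.-integrable [set: plane] (EFin \o pairing f g).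
Proof.
move=> Lf Lg; have := Lf; have := Lg; rewrite !inE => -[[mg _] _] [[mf _] _].
apply: le_integrable (integrableD _ (L2w_integrable_sqr Lf) (L2w_integrable_sqr Lg)) => //.
  by apply/measurable_EFinP; exact: measurable_pairing.
move=> p _ /=; rewrite lee_fin [leRHS]ger0_norm ?addr_ge0 ?pairing_ge0 //.
rewrite /pairing normrM (ger0_norm (gauss_ge0 p)) -mulrDl ler_wpM2r ?gauss_ge0 //.
move: (repart f p) (repart g p) (impart f p) (impart g p) => a b c d.
have := sqr_ge0 (a - b); have := sqr_ge0 (a + b).
have := sqr_ge0 (c - d); have := sqr_ge0 (c + d).
rewrite ler_norml !expr2 => h1 h2 h3 h4.
by apply/andP; split; nra.
Qed.

Lemma dot_wsqnorm f : f \in @L2w R -> wsqnorm f = (dot f f)%:E.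
Proof.
move=> Lf; rewrite wsqnormE fineK //.
exact: integrable_fin_num (L2w_integrable Lf Lf).
Qed.

(** Local square integrability is implied, as the Gaussian is bounded below on
    compact sets. *)
Lemma L2w_of_wsqnorm f : cmeasurable f -> (wsqnorm f < +oo)%E -> f \in @L2w R.
Proof.
move=> mf ff; rewrite inE; split => //; split => // K cK.
have [B [_ /(_ (B + 1))]] := compact_bounded cK.
rewrite ltrDl ltr01 => /(_ isT) hB.
pose c := expR (2 * (B + 1) ^+ 2).
have mK := compact_area_measurable cK.
have mn : measurable_fun [set: plane] (fun p => (pairing f f p)%:E).
  by apply/measurable_EFinP; exact: measurable_pairing.
have p0 p : (0 <= (pairing f f p)%:E)%E by rewrite lee_fin pairing_ge0.
apply: (@le_lt_trans _ _ (\int[area]_(p in K) (c%:E * (pairing f f p)%:E)))%E.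
  apply: ge0_le_integral => //.
  - by move=> p _; rewrite lee_fin sqr_ge0.
  - by apply/measurable_EFinP; apply: measurable_funTS; exact: measurable_normc2.
  - by apply: measurable_funeM; exact: measurable_funTS.
  - move=> p Kp; rewrite -EFinM lee_fin pairing_sqr mulrCA ler_peMr ?sqr_ge0 //.
    rewrite /c /gauss -expRD -[leLHS]expR0 ler_expR (normc2E id) /=.
    have : `|p| <= B + 1 := hB p Kp.
    rewrite prod_normE ge_max => /andP[p1 p2].
    have s1 := lerXn2r 2 (normr_ge0 p.1) (le_trans (normr_ge0 _) p1) p1.
    have s2 := lerXn2r 2 (normr_ge0 p.2) (le_trans (normr_ge0 _) p2) p2.
    move: s1 s2; rewrite !real_normK ?num_real // /repart /impart /=; lra.
rewrite ge0_integralZl ?lee_fin ?expR_ge0 //; last exact: measurable_funTS.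
rewrite lte_mul_pinfty ?lee_fin ?expR_ge0 //.
apply: le_lt_trans ff; rewrite wsqnormE.
exact: ge0_subset_integral.
Qed.

Lemma dotC f g : dot f g = dot g f.
Proof.
by apply: eq_Rintegral => p _; rewrite /pairing mulrC (mulrC (repart f p))
  (mulrC (impart f p)) mulrC.
Qed.

Lemma dotD f g h : f \in @L2w R -> g \in @L2w R -> h \in @L2w R ->
  dot (f + g) h = dot f h + dot g h.
Proof.
move=> Lf Lg Lh; rewrite /dot -RintegralD //; try exact: L2w_integrable.
by apply: eq_Rintegral => p _; rewrite /pairing repartD impartD; ring.
Qed.

Lemma dotZ (t : R) f g : f \in @L2w R -> g \in @L2w R ->
  dot (t%:C *: f) g = t * dot f g.
Proof.
move=> Lf Lg; rewrite /dot -RintegralZl //; last exact: L2w_integrable.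
by apply: eq_Rintegral => p _; rewrite /pairing repartZ impartZ /=; ring.
Qed.

Lemma dot_conj c f g : dot (c *: f) g = dot f (c^*%C *: g).
Proof.
apply: eq_Rintegral => p _; rewrite /pairing !repartZ !impartZ.
by case: c => a b /=; ring.
Qed.

Lemma dot_ge0 f : 0 <= dot f f.
Proof. by apply: Rintegral_ge0 => p _; exact: pairing_ge0. Qed.

Definition inner (u v : L2 R) : R := dot u v.

Lemma L2repr_L2w (u : L2 R) : L2_repr u \in @L2w R.
Proof. exact: (valP (repr u)). Qed.

Lemma dot_ae f f' g : f \in @L2w R -> f' \in @L2w R -> g \in @L2w R ->
  {ae area, forall p, f (toC p) = f' (toC p)} -> dot f g = dot f' g.
Proof.
move=> Lf Lf' Lg ff'; rewrite /dot /Rintegral; congr fine.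
have m h : h \in @L2w R -> measurable_fun [set: plane] (EFin \o pairing h g).
  by move=> Lh; exact: measurable_int (L2w_integrable Lh Lg).
apply: ae_eq_integral => //; [exact: (m f)|exact: (m f')|].
have F := ae_filter_ringOfSetsType area.
by apply: filterS ff' => p E _; rewrite /pairing /repart /impart E.
Qed.

Lemma inner_pi (f g : L2fun R) : inner (\pi_(L2 R) f) (\pi_(L2 R) g) = dot f g.
Proof.
have e (h : L2fun R) := L2_repr_pi h.
have L := L2repr_L2w; have V (h : L2fun R) : (h : R[i] -> R[i]) \in @L2w R := valP h.
rewrite /inner (dot_ae (L _) (V f) (L _) (e f)).
by rewrite dotC (dot_ae (L _) (V g) (V f) (e g)) dotC.
Qed.

Lemma innerC (u v : L2 R) : inner u v = inner v u.
Proof. exact: dotC. Qed.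

Lemma innerD (u v w : L2 R) : inner (u + v) w = inner u w + inner v w.
Proof.
elim/quotW: u => f; elim/quotW: v => g; elim/quotW: w => h.
by rewrite -pi_L2add !inner_pi dotD //; exact: valP.
Qed.

Lemma innerZ (t : R) (u v : L2 R) : inner (t%:C *: u) v = t * inner u v.
Proof.
elim/quotW: u => f; elim/quotW: v => g.
have -> : t%:C *: \pi_(L2 R) f = \pi_(L2 R) (t%:C *: f) by rewrite pi_L2scale.
by rewrite !inner_pi dotZ //; exact: valP.
Qed.

Lemma inner_conj c (u v : L2 R) : inner (c *: u) v = inner u (c^*%C *: v).
Proof.
elim/quotW: u => f; elim/quotW: v => g.
have E d h : d *: \pi_(L2 R) h = \pi_(L2 R) (d *: h) by rewrite pi_L2scale.
by rewrite !E !inner_pi; exact: dot_conj.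
Qed.

Lemma inner_ge0 (u : L2 R) : 0 <= inner u u.
Proof. exact: dot_ge0. Qed.

Lemma L2norm_inner (u : L2 R) : L2norm u = Num.sqrt (inner u u).
Proof. by rewrite /L2norm /wnorm dot_wsqnorm //; exact: L2repr_L2w. Qed.

Lemma inner_eq0 (u : L2 R) : inner u u = 0 -> u = 0.
Proof.
elim/quotW: u => f; rewrite inner_pi => f0.
have Lf : (f : R[i] -> R[i]) \in @L2w R := valP f.
apply/eqP; have -> : (0 : L2 R) = \pi_(L2 R) 0.
  rewrite -(scale0r (\pi_(L2 R) 0)) -[0 in RHS](scale0r (0 : L2fun R)).
  by rewrite pi_L2scale.
apply/L2_eqP.
have : (\int[area]_p `|(pairing f f p)%:E| = 0)%E.
  under eq_integral do rewrite gee0_abs ?lee_fin ?pairing_ge0 //.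
  by rewrite -wsqnormE dot_wsqnorm // f0.
move/ae_eq_integral_abs => /(_ measurableT).
have := measurable_int _ (L2w_integrable Lf Lf) => mp /(_ mp).
have F := ae_filter_ringOfSetsType area.
apply: filterS => p /(_ I) [] /eqP.
rewrite pairing_sqr mulf_eq0 sqrf_eq0 [gauss p == 0]gt_eqF ?expR_gt0 // orbF.
by move=> /eqP /Normc.eq0_normc ->.
Qed.

End weighted_L2.

Section completeness.
Local Open Scope complex_scope.
Variable R : realType.
Implicit Types (f g : R[i] -> R[i]) (p : R * R).

Local Notation area := ((@lebesgue_measure R) \x (@lebesgue_measure R))%E.
Local Notation plane := (measurableTypeR R * measurableTypeR R)%type.
Local Open Scope quotient_scope.

Lemma measurable_expR_normc2 (c : R) :
  measurable_fun [set: plane] (fun p => expR (c * Normc.normc (toC p) ^+ 2)).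
Proof.
apply: measurableT_comp => //; apply: measurable_funM => //.
by apply: (@measurable_normc2 _ id); split; [exact: measurable_fst|exact: measurable_snd].
Qed.

Lemma repartB f g p : repart (f - g) p = repart f p - repart g p.
Proof. by rewrite /repart ReD ReN. Qed.

Lemma impartB f g p : impart (f - g) p = impart f p - impart g p.
Proof. by rewrite /impart ImD ImN. Qed.

Lemma inner_piB (f g : L2fun R) :
  inner (\pi_(L2 R) f - \pi_(L2 R) g) (\pi_(L2 R) f - \pi_(L2 R) g) =
  dot (L2fun_val f - L2fun_val g) (L2fun_val f - L2fun_val g).
Proof.
have -> : \pi_(L2 R) f - \pi_(L2 R) g = \pi_(L2 R) (f - g).
  by rewrite -scaleN1r -[in RHS]scaleN1r pi_L2add pi_L2scale.
by rewrite inner_pi.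
Qed.

(** Multiplication by [s = exp (- |z|^2 / 2)] is an isometry onto the unweighted
    space, where [riesz_fischer] applies to the real and imaginary parts. *)
Lemma L2_fast_complete : fast_complete (@inner R).
Proof.
move=> x fast; pose f n := L2_repr (x n).
have Lf n : f n \in @L2w R := L2repr_L2w (x n).
have mf n : cmeasurable (f n) by have := Lf n; rewrite inE => -[[]].
pose s p := expR (- 2^-1 * Normc.normc (toC p) ^+ 2).
pose si p := expR (2^-1 * Normc.normc (toC p) ^+ 2).
have ssi p : s p * si p = 1 by rewrite -expRD mulNr addNr expR0.
have ss p : s p ^+ 2 = gauss p.
  by rewrite /s /gauss expr2 -expRD; congr expR; field.
have ms : measurable_fun [set: plane] s by exact: measurable_expR_normc2.
have msi : measurable_fun [set: plane] si by exact: measurable_expR_normc2.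
have LB g h : g \in @L2w R -> h \in @L2w R -> g - h \in @L2w R.
  by move=> Lg Lh; exact: rpredB.
have wB n : (wsqnorm (f n.+1 - f n)%R <= ((4 ^+ n)^-1)%:E)%E.
  rewrite dot_wsqnorm ?lee_fin; last exact: LB.
  apply: le_trans (fast n).
  by rewrite -[x n.+1]reprK -[x n in leRHS]reprK inner_piB.
have mpB n : measurable_fun [set: plane]
    (fun p => (pairing (f n.+1 - f n) (f n.+1 - f n) p)%:E).
  exact: measurable_int (L2w_integrable (LB _ _ (Lf _) (Lf _)) (LB _ _ (Lf _) (Lf _))).
pose g1 n p := repart (f n) p * s p; pose g2 n p := impart (f n) p * s p.
have mg1 n : measurable_fun [set: plane] (g1 n).
  by apply: measurable_funM => //; have [] := mf n.
have mg2 n : measurable_fun [set: plane] (g2 n).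
  by apply: measurable_funM => //; have [] := mf n.
have fast1 n : (\int[area]_p ((g1 n.+1 p - g1 n p) ^+ 2)%:E <= ((4 ^+ n)^-1)%:E)%E.
  apply: le_trans (wB n); rewrite wsqnormE; apply: ge0_le_integral => //.
  - by move=> p _; rewrite lee_fin sqr_ge0.
  - by apply/measurable_EFinP; apply: measurable_funX; exact: measurable_funB.
  - move=> p _; rewrite lee_fin /pairing repartB impartB -ss -mulrBl exprMn.
    by rewrite -!expr2 ler_wpM2r ?sqr_ge0 // lerDl sqr_ge0.
have fast2 n : (\int[area]_p ((g2 n.+1 p - g2 n p) ^+ 2)%:E <= ((4 ^+ n)^-1)%:E)%E.
  apply: le_trans (wB n); rewrite wsqnormE; apply: ge0_le_integral => //.
  - by move=> p _; rewrite lee_fin sqr_ge0.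
  - by apply/measurable_EFinP; apply: measurable_funX; exact: measurable_funB.
  - move=> p _; rewrite lee_fin /pairing repartB impartB -ss -mulrBl exprMn.
    by rewrite -!expr2 ler_wpM2r ?sqr_ge0 // lerDr sqr_ge0.
have [l1 ml1 hl1] := riesz_fischer mg1 fast1.
have [l2 ml2 hl2] := riesz_fischer mg2 fast2.
pose u z := (l1 (ofC z) * si (ofC z)) +i* (l2 (ofC z) * si (ofC z)).
have ru : repart u = fun p => l1 p * si p.
  by apply/funext => p; rewrite /repart /= toCK.
have iu : impart u = fun p => l2 p * si p.
  by apply/funext => p; rewrite /impart /= toCK.
have mu : cmeasurable u by split; rewrite ?ru ?iu; exact: measurable_funM.
have wu n : (wsqnorm (u - f n)%R <= (8 / 4 ^+ n)%:E)%E.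
  rewrite wsqnormE (eq_integral (fun p : plane => ((l1 p - g1 n p) ^+ 2)%:E +
      ((l2 p - g2 n p) ^+ 2)%:E)%E); last first.
    move=> p _; rewrite -EFinD /pairing !repartB !impartB -ss ru iu /g1 /g2.
    have q (y z : R) : y - z * s p = (y * si p - z) * s p.
      by rewrite mulrBl -mulrA (mulrC (si p)) ssi mulr1.
    by congr EFin; rewrite !q; ring.
  have m1 : measurable_fun [set: plane] (fun p => ((l1 p - g1 n p) ^+ 2)%:E).
    by apply/measurable_EFinP; apply: measurable_funX; exact: measurable_funB.
  have m2 : measurable_fun [set: plane] (fun p => ((l2 p - g2 n p) ^+ 2)%:E).
    by apply/measurable_EFinP; apply: measurable_funX; exact: measurable_funB.
  rewrite ge0_integralD //; try by move=> p _; rewrite lee_fin sqr_ge0.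
  have -> : 8 / 4 ^+ n = 4 / 4 ^+ n + 4 / 4 ^+ n :> R by rewrite -mulrDl -natrD.
  by rewrite EFinD; exact: leeD (hl1 n) (hl2 n).
have Lu : u \in @L2w R.
  rewrite -(subrK (f 0%N) u); apply: rpredD => //.
  apply: L2w_of_wsqnorm; last exact: le_lt_trans (wu 0%N) (ltry _).
  have [mu1 mu2] := mu; have [mf1 mf2] := mf 0%N.
  split.
    rewrite (_ : repart _ = fun p => repart u p - repart (f 0%N) p).
      exact: measurable_funB.
    by apply/funext => p; exact: repartB.
  rewrite (_ : impart _ = fun p => impart u p - impart (f 0%N) p).
    exact: measurable_funB.
  by apply/funext => p; exact: impartB.
exists (\pi_(L2 R) (MkL2fun Lu)) => e e0.
have /cvgr0Pnorm_lt/(_ _ (divr_gt0 e0 (ltr0n _ 8)))[M _ hM] :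
    (fun n => (4^-1 : R) ^+ n) @ \oo --> (0 : R).
  by apply: cvg_expr; rewrite ger0_norm // invf_lt1 // ltr1n.
exists M => n /hM /=; rewrite exprVn ger0_norm ?invr_ge0 ?exprn_ge0 // => he.
rewrite -[x n]reprK inner_piB -lte_fin -(dot_wsqnorm (LB _ _ Lu (Lf n))).
apply: le_lt_trans (wu n) _; rewrite lte_fin mulrC -ltr_pdivlMr //.
Qed.

(** The function that represents integration against [phi] in the Gaussian inner
    product. *)
Definition dual_of (phi : R[i] -> R[i]) : R[i] -> R[i] :=
  fun z => (weight (ofC z))%:C * (phi z)^*%C.

Lemma repart_dual phi p : repart (dual_of phi) p = weight p * repart phi p.
Proof. by rewrite /repart /dual_of ReM toCK; case: (phi _) => a b /=; ring. Qed.

Lemma impart_dual phi p : impart (dual_of phi) p = - (weight p * impart phi p).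
Proof. by rewrite /impart /dual_of ImM toCK; case: (phi _) => a b /=; ring. Qed.

Lemma pairing_dual f phi p : pairing f (dual_of phi) p = repart (f * phi) p.
Proof.
rewrite /pairing repart_dual impart_dual gaussE /repart ReM -/(repart _ _) -/(repart _ _).
rewrite -/(impart _ _) -/(impart _ _).
by field; rewrite gt_eqF ?weight_gt0.
Qed.

Lemma wsqnorm_dual phi : ctest phi -> wsqnorm (dual_of phi) = (energy phi phi)%:E.
Proof.
move=> [b1 b2]; have [s1 _] := b1; have [s2 _] := b2.
have b := bumpD (bumpM s1 b1) (bumpM s2 b2).
rewrite wsqnormE /energy /wint fineK; last first.
  exact: integrable_fin_num (bump_weight_integrable b).
apply: eq_integral => p _; congr (_%:E).
rewrite /pairing repart_dual impart_dual gaussE.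
by field; rewrite gt_eqF ?weight_gt0.
Qed.

Lemma dual_L2w phi : ctest phi -> dual_of phi \in @L2w R.
Proof.
move=> tp; apply: L2w_of_wsqnorm; last by rewrite wsqnorm_dual // ltry.
have [[s1 _] [s2 _]] := tp.
have m h : smooth h -> measurable_fun [set: plane] (fun p => weight p * h p).
  move=> sh; apply: continuous_plane_measurable => p.
  by apply: cvgM; [exact: continuous_weight|exact: smooth_continuous].
split.
  by rewrite (_ : repart _ = fun p => weight p * repart phi p);
    [exact: m|apply/funext => p; exact: repart_dual].
rewrite (_ : impart _ = fun p => - (weight p * impart phi p)).
  by apply: measurableT_comp => //; exact: m.
by apply/funext => p; exact: impart_dual.
Qed.

End completeness.

(** * Weak solutions *)

Section weak_solutions.
Local Open Scope complex_scope.
Variable R : realType.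
Implicit Types (f g u phi : R[i] -> R[i]) (p : R * R).

Local Open Scope quotient_scope.

Lemma ctest_iter k phi : ctest phi -> ctest (iter k (@creation R) phi).
Proof. by move=> tp; elim: k => //= k; exact: ctest_creation. Qed.

Lemma iter_creation_lin k c f g : ctest f -> ctest g ->
  iter k (@creation R) (c *: f + g) =
  c *: iter k (@creation R) f + iter k (@creation R) g.
Proof.
move=> tf tg; elim: k => // k IH; rewrite !iterS IH.
have tfk := ctest_iter k tf; have tgk := ctest_iter k tg.
by rewrite (creationD (ctestZ c tfk) tgk) (creationZ c tfk).
Qed.

Lemma iter_creationZ k c f : ctest f ->
  iter k (@creation R) (c *: f) = c *: iter k (@creation R) f.
Proof.
move=> tf; elim: k => // k IH; rewrite !iterS IH.
exact: creationZ (ctest_iter k tf).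
Qed.

Lemma iter_dbar k phi : ctest phi ->
  iter k (@dbar R) phi = ((-1) ^+ k : R)%:C *: iter k (@creation R) phi.
Proof.
move=> tp; elim: k => [|k IH]; first by rewrite expr0 scale1r.
rewrite iterS IH -[dbar _]opprK -[- dbar _]/(creation _).
rewrite (creationZ _ (ctest_iter k tp)) -iterS -scaleNr.
by rewrite exprS mulN1r rmorphN.
Qed.

(** Total in [f], with value [0] when [f] is not square integrable, so that
    classes can be formed without carrying membership proofs. *)
Definition L2class f : L2 R := \pi_(L2 R) (insubd (0 : L2fun R) f).

Lemma L2class_lin c f g : f \in @L2w R -> g \in @L2w R ->
  c *: L2class f + L2class g = L2class (c *: f + g).
Proof.
move=> Lf Lg; have Ls : c *: f + g \in @L2w R by apply: rpredD => //; exact: rpredZ.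
rewrite /L2class.
have -> : insubd (0 : L2fun R) (c *: f + g) =
    c *: insubd (0 : L2fun R) f + insubd (0 : L2fun R) g.
  apply: val_inj; rewrite insubdK //.
  rewrite -[in LHS](insubdK (0 : L2fun R) Lf) -[in LHS](insubdK (0 : L2fun R) Lg).
  by [].
by rewrite pi_L2add pi_L2scale.
Qed.

Lemma inner_L2class (u : L2 R) f : f \in @L2w R -> inner u (L2class f) = dot u f.
Proof.
move=> Lf; rewrite -[u in LHS]reprK inner_pi.
by rewrite -[in RHS](insubdK (0 : L2fun R) Lf).
Qed.

Lemma inner_L2classL f g : f \in @L2w R -> g \in @L2w R ->
  inner (L2class f) (L2class g) = dot f g.
Proof.
move=> Lf Lg; rewrite /L2class inner_pi.
by rewrite -[in RHS](insubdK (0 : L2fun R) Lf) -[in RHS](insubdK (0 : L2fun R) Lg).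
Qed.

Lemma dual_lin c f g : c *: dual_of f + dual_of g = dual_of (c^*%C *: f + g).
Proof.
apply/funext => z; rewrite [LHS](_ : _ = c * dual_of f z + dual_of g z) //.
rewrite /dual_of; have -> : (c^*%C *: f + g) z = c^*%C * f z + g z by [].
case: c (f z) (g z) => c1 c2 [f1 f2] [g1 g2]; apply/eqP.
by rewrite eq_complex /=; apply/andP; split; apply/eqP; ring.
Qed.

Lemma dualD f g : dual_of (f + g) = dual_of f + dual_of g.
Proof. by have := dual_lin 1 f g; rewrite conjc1 !scale1r. Qed.

Section adjoint_graph.
Variables (k : nat) (a : R[i]).
Hypothesis k_gt0 : (0 < k)%N.

(** The formal transpose of [dbar^k + a]; conjugated by [dual_of] it becomes the
    adjoint in the Gaussian space. *)
Definition adjoint phi := iter k (@creation R) phi + a *: phi.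

Lemma ctest_adjoint phi : ctest phi -> ctest (adjoint phi).
Proof. by move=> tp; exact: ctestD (ctest_iter k tp) (ctestZ a tp). Qed.

Lemma adjoint_lin c f g : ctest f -> ctest g ->
  adjoint (c *: f + g) = c *: adjoint f + adjoint g.
Proof.
move=> tf tg; rewrite /adjoint iter_creation_lin // !scalerDr !scalerA (mulrC a).
by rewrite addrACA.
Qed.

Definition adjoint_graph (x y : L2 R) := exists phi,
  [/\ ctest phi, x = L2class (dual_of (adjoint phi)) & y = L2class (dual_of phi)].

(** [dual_of] is conjugate linear, so scaling the pair by [c] scales the underlying
    test function by the conjugate of [c]. *)
Lemma adjoint_graph_lin c x y x' y' : adjoint_graph x y -> adjoint_graph x' y' ->
  adjoint_graph (c *: x + x') (c *: y + y').
Proof.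
move=> [phi [tp -> ->]] [psi [ts -> ->]]; exists (c^*%C *: phi + psi).
split; first exact: ctestD (ctestZ _ tp) ts.
- rewrite L2class_lin; [|exact: dual_L2w (ctest_adjoint _)..].
  by rewrite dual_lin adjoint_lin.
- by rewrite L2class_lin ?dual_lin; [|exact: dual_L2w..].
Qed.

Lemma ctest0 : ctest (0 : R[i] -> R[i]).
Proof. by split; exact: bump0. Qed.

Lemma adjoint_graph0 : adjoint_graph 0 0.
Proof.
have g : adjoint_graph (L2class (dual_of (adjoint 0))) (L2class (dual_of 0)).
  by exists 0; split => //; exact: ctest0.
have := adjoint_graph_lin (-1) g g.
by rewrite !scaleN1r !addNr.
Qed.

Lemma adjoint_graph_coercive x y : adjoint_graph x y ->
  k`!%:R * inner y y <= inner x x.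
Proof.
move=> [phi [tp -> ->]]; have ta := ctest_adjoint tp.
have L1 := dual_L2w tp; have L2 := dual_L2w ta.
rewrite !inner_L2classL //.
have E psi : ctest psi -> dot (dual_of psi) (dual_of psi) = energy psi psi.
  by move=> ts; apply: EFin_inj; rewrite -wsqnorm_dual // dot_wsqnorm //; exact: dual_L2w.
by rewrite !E //; exact: energy_coercive.
Qed.

(** The real part of [- i * w] is the imaginary part of [w], so that real inner
    products with two test functions recover the complex integral. *)
Lemma cintegral_dot f phi : cintegral (fun z => f z * phi z) =
  dot f (dual_of phi) +i* dot f (dual_of ((- 'i%C) *: phi)).
Proof.
rewrite /cintegral /dot; congr (_ +i* _); apply: eq_Rintegral => p _.
  by rewrite pairing_dual.
rewrite pairing_dual /repart /impart.
have -> : (f * (- 'i%C *: phi)) (toC p) = - 'i%C * (f (toC p) * phi (toC p)).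
  by rewrite mulrCA.
by rewrite [RHS]ReM /=; ring.
Qed.

Lemma dotDr f g h : f \in @L2w R -> g \in @L2w R -> h \in @L2w R ->
  dot f (g + h) = dot f g + dot f h.
Proof. by move=> *; rewrite dotC dotD // !(dotC f). Qed.

(** The relations at [phi] and [- i * phi] give the real and the imaginary parts of
    the weak equation. *)
Lemma weak_solution_of_adjoint (f u : L2 R) :
  (forall x y, adjoint_graph x y -> inner u x = inner f y) ->
  weak_solution k a f u.
Proof.
move=> orth phi /test_function_ctest tp.
have Lu := L2repr_L2w u; have Lf := L2repr_L2w f.
have key psi : ctest psi -> dot u (dual_of (iter k (@creation R) psi)) =
    dot (L2_repr f - a *: L2_repr u) (dual_of psi).
  move=> ts; have tk := ctest_iter k ts; have ta := ctestZ a ts.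
  have Ld := dual_L2w ts; have Lk := dual_L2w tk; have La := dual_L2w ta.
  have := orth _ _ (ex_intro _ psi (And3 ts erefl erefl)).
  rewrite !inner_L2class //; last exact: dual_L2w (ctest_adjoint ts).
  rewrite dualD dotDr // => e.
  rewrite -scaleNr addrC dotD //; last exact: rpredZ.
  rewrite -e addrC -addrA -[LHS]addr0; congr (_ + _).
  have -> : dot (- a *: L2_repr u) (dual_of psi) =
      (-1) * dot (L2_repr u) (dual_of (a *: psi)).
    have -> : - a *: L2_repr u = (-1 : R)%:C *: (a *: L2_repr u).
      by rewrite rmorphN rmorph1 scaleN1r scaleNr.
    rewrite dotZ //; last exact: rpredZ.
    congr (_ * _); apply: eq_Rintegral => p _; rewrite !pairing_dual.
    congr (complex.Re _).
    have -> : (a *: L2_repr u * psi) (toC p) = a * u (toC p) * psi (toC p) by [].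
    by rewrite (mulrC a) -mulrA.
  by rewrite mulN1r subrr.
rewrite (iter_dbar k tp); set s : R := (-1) ^+ k.
have -> : (-1) ^+ k = s%:C :> R[i] by rewrite rmorphXn rmorphN rmorph1.
have tk := ctest_iter k tp.
have dZ psi : ctest psi -> dot u (dual_of (s%:C *: psi)) = s * dot u (dual_of psi).
  move=> ts; have -> : dual_of (s%:C *: psi) = s%:C *: dual_of psi + dual_of 0.
    by rewrite dual_lin addr0 conjc_real.
  have -> : dual_of 0 = 0 :> (R[i] -> R[i]).
    apply/funext => z; rewrite /dual_of.
    by rewrite (_ : (0 : R[i] -> R[i]) z = 0) // conjc0 mulr0.
  by rewrite addr0 dotC dotZ ?(dotC u) //; exact: dual_L2w.
rewrite (cintegral_dot u) (cintegral_dot (L2_repr f - a *: L2_repr u)).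
rewrite scalerA (mulrC (- 'i%C)) -scalerA !dZ //; last exact: ctestZ.
rewrite -iter_creationZ // !key //; last exact: ctestZ.
by apply/eqP; rewrite eq_complex /= !mul0r subr0 addr0 !eqxx.
Qed.

End adjoint_graph.
End weak_solutions.

Theorem theorem3p1 (R : realType) (k : nat) (a : R[i]) :
  (0 < k)%N ->
  exists T : {linear L2 R -> L2 R},
    [/\ bounded_operator T,
        (operator_norm T <= ((Num.sqrt k`!%:R)^-1)%:E)%E &
        forall f : L2 R, weak_solution k a f (T f : L2 R)].
Proof.
move=> k0; have fk0 : 0 < k`!%:R :> R by rewrite ltr0n fact_gt0.
have [T TP] := coercive_graph_operator (@innerD R) (@innerC R) (@innerZ R)
  (@inner_conj R) (@inner_ge0 R) (@inner_eq0 R) (@L2_fast_complete R) fk0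
  (adjoint_graph0 k a) (@adjoint_graph_lin R k a)
  (@adjoint_graph_coercive R k a k0).
have bound u : L2norm (T u) <= (Num.sqrt k`!%:R)^-1 * L2norm u.
  rewrite mulrC ler_pdivlMr ?sqrtr_gt0 // !L2norm_inner mulrC -(sqrtrM _ (ltW fk0)).
  by apply: ler_wsqrtr; have [] := TP u.
exists T; split.
- by exists (Num.sqrt k`!%:R)^-1.
- apply: ge_ereal_sup => _ [u /= u1 <-]; rewrite lee_fin.
  apply: le_trans (bound u) _; rewrite -[leRHS]mulr1; apply: ler_wpM2l u1.
  by rewrite invr_ge0 sqrtr_ge0.
- by move=> f; apply: weak_solution_of_adjoint; have [] := TP f.
Qed.
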